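(* Let $\mathbf{G}=\mathrm{Aut}(\mathbf{M})$ and let $H$ be a subgroup of $\mathbf{G}$ with $[\mathbf{G}:H]<2^{\aleph_0}$. Then there exist a finite set $A\subseteq\mathbf{M}$ and $X=\mathrm{gcl}(A)$ such that $\mathbf{G}_X\leq H$, where $\mathbf{G}_X=\{g\in\mathbf{G}: g(x)=x \text{ for all } x\in X\}$.
   Context: Fix an integer $\mathfrak{m}\ge 2$. All structures are graphs, i.e. structures in a language with one binary relation $\mathcal{R}$ that is irreflexive and symmetric; $\mathcal{R}(A)$ denotes the set of edges of $A$. For a finite graph $A$ put $\delta(A)=\mathfrak{m}\cdot|A|-|\mathcal{R}(A)|$. For finite graphs $A\subseteq B$ write $A\leqslant B$ ($A$ is $\leqslant$-closed in $B$) iff $\delta(A')\ge\delta(A)$ for all $A\subseteq A'\subseteq B$; for an infinite graph $N$ and $A\subseteq N$, $A\leqslant N$ means $A\leqslant B$ for every finite $B\subseteq N$ containing $A$. Let $\mathsf{K_0}$ be the class of finite graphs $A$ with $\delta(A')\ge 0$ for all $A'\subseteq A$. $\mathbf{M}$ denotes the $(\mathsf{K_0},\leqslant)$-generic structure: the unique countable graph which is the union of a chain of finite $\leqslant$-closed subsets, in which every isomorphism between finite $\leqslant$-closed subsets extends to an automorphism of $\mathbf{M}$, and such that every element of $\mathsf{K_0}$ is isomorphic to a $\leqslant$-closed subset of $\mathbf{M}$. For finite $A\subseteq\mathbf{M}$, $\mathrm{cl}(A)$ is the smallest finite $\leqslant$-closed subset of $\mathbf{M}$ containing $A$, $\mathrm{d}(A)=\delta(\mathrm{cl}(A))$,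 and $\mathrm{d}(m/A)=\mathrm{d}(\{m\}\cup A)-\mathrm{d}(A)$. For $X\subseteq\mathbf{M}$, $\mathrm{gcl}(X)=\{m\in\mathbf{M}:\mathrm{d}(m/A)=0\text{ for some finite }A\subseteq X\}$. *)

(* Defs.v *)
From HB Require Import structures.
From mathcomp Require Import all_boot all_order all_algebra.
Set Implicit Arguments. Unset Strict Implicit. Unset Printing Implicit Defensive.
Import Order.TTheory GRing.Theory Num.Theory.

(* Graphs: a carrier type with a boolean edge relation, assumed irreflexive
   and symmetric where needed.  Finite subsets are represented by
   sequences (only their members matter). *)

Section Delta.
Variables (V : eqType) (R : rel V) (mm : nat).

Definition fcard (A : seq V) : nat := size (undup A).

(* |R(A)| : number of (unordered) edges inside A; for R irreflexive and
   symmetric every edge is counted twice in the double sum. *)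
Definition nedges (A : seq V) : nat :=
  (\sum_(x <- undup A) \sum_(y <- undup A) (R x y : nat)) %/ 2.

Definition delta (A : seq V) : int := ((mm * fcard A)%:Z - (nedges A)%:Z)%R.

Definition leq_closed (A B : seq V) : Prop :=
  {subset A <= B} /\
  forall A' : seq V, {subset A <= A'} -> {subset A' <= B} ->
    (delta A <= delta A')%R.

Definition closed_in (A : seq V) : Prop :=
  forall B : seq V, {subset A <= B} -> leq_closed A B.

End Delta.

Definition graph_rel (V : Type) (R : rel V) : Prop :=
  irreflexive R /\ symmetric R.

Definition in_K0 (mm n : nat) (E : rel 'I_n) : Prop :=
  graph_rel E /\ forall A' : seq 'I_n, (0 <= delta E mm A')%R.

Definition is_aut (T : Type) (R : rel T) (g : T -> T) : Prop :=
  bijective g /\ forall x y, R (g x) (g y) = R x y.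

Definition is_generic (mm : nat) (T : countType) (R : rel T) : Prop :=
  graph_rel R /\
  (exists C : nat -> seq T,
      (forall k, closed_in R mm (C k)) /\
      (forall k, {subset C k <= C k.+1}) /\
      (forall x, exists k, x \in C k)) /\
  (forall (A B : seq T) (h : T -> T),
      closed_in R mm A -> closed_in R mm B ->
      {in A &, injective h} ->
      (forall x, x \in A -> h x \in B) ->
      (forall y, y \in B -> exists2 x, x \in A & h x = y) ->
      {in A &, forall x y, R (h x) (h y) = R x y} ->
      exists g, is_aut R g /\ {in A, forall x, g x = h x}) /\
  (forall (n : nat) (E : rel 'I_n), in_K0 mm E ->
      exists f : 'I_n -> T,
        injective f /\ (forall i j, R (f i) (f j) = E i j) /\
        closed_in R mm (map f (enum 'I_n))).

Section Closure.
Variables (T : countType) (R : rel T) (mm : nat).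

Definition is_cl (A C : seq T) : Prop :=
  closed_in R mm C /\ {subset A <= C} /\
  forall D : seq T, closed_in R mm D -> {subset A <= D} -> {subset C <= D}.

(* d(a / A) = 0, i.e. d({a} u A) = d(A) *)
Definition d_rel_zero (a : T) (A : seq T) : Prop :=
  exists C1 C2 : seq T,
    is_cl (a :: A) C1 /\ is_cl A C2 /\ delta R mm C1 = delta R mm C2.

Definition gcl (X : T -> Prop) (a : T) : Prop :=
  exists A : seq T, (forall x, x \in A -> X x) /\ d_rel_zero a A.

End Closure.

Definition is_subgroup (T : Type) (R : rel T) (H : (T -> T) -> Prop) : Prop :=
  (forall g, H g -> is_aut R g) /\
  H id /\
  (forall f g, H f -> H g -> H (f \o g)) /\
  (forall f g, H f -> (forall x, g (f x) = x) -> H g).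

(* [Aut : H] < 2^aleph_0 : there is no injection of 2^omega into the set of
   left cosets of H, i.e. no continuum family of automorphisms lying in
   pairwise distinct left cosets. *)
Definition index_lt_continuum (T : Type) (R : rel T) (H : (T -> T) -> Prop)
  : Prop :=
  ~ exists F : (nat -> bool) -> (T -> T),
      (forall s, is_aut R (F s)) /\
      (forall s t, s <> t ->
         ~ exists h, H h /\ forall x, F t x = F s (h x)).

(* Main.v *)
Require Import Defs.
From HB Require Import structures.
From mathcomp Require Import all_boot all_order all_algebra.
From mathcomp Require Import zify boolp.
Set Implicit Arguments. Unset Strict Implicit. Unset Printing Implicit Defensive.
Import Order.TTheory.

(* Call a set small if it is gcl(A) for a finite A.  The predimension gives two
   facts.  (EPPA) An automorphism mapping the small set X into the small set V,
   with X in V, can be changed off X so as to stabilise V: when V is larger than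
   X, a new vertex of V joined to a point of V outside X and to mm - 1 points of X
   has dimension one over X, and dimension is the only invariant of V over X.
   (Amalgamation) After an automorphism fixing the small set V pointwise, two small
   sets containing V are in free position over V, and automorphisms of the two that
   agree on V have a common extension.

   Suppose H contains no pointwise stabiliser of a small set.  Pick for each small
   set an automorphism fixing it and outside H, and close these countably many
   automorphisms under composition, inverse, EPPA and amalgamation; the closure is
   still countable.  Working in the Polish group it generates, with small sets in
   the role of finite ones, generic n-tuples exist for all n and are conjugate over
   their stable small sets.  Hence, as for ample generics, there are generic
   p_0, p_1, ... and a perfect tree of automorphisms f_s such that
   f_s^-1 p_i f_s lies in H iff s_i = 0; the f_s represent continuum many cosets. *)

(** * Predimension of finite graphs *)

(** Small sets are infinite, so one small set can carry continuum many germs of automorphisms, and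
    there is no reason for Aut(M), with the pointwise stabilisers of small sets as basic open
    subgroups, to be separable. A category argument there would have uncountably many conditions to
    meet. A countable subgroup that contains witnesses for all its own extension problems leaves
    only countably many conditions, and its closure is large enough to contain the generic tuples.
    Free position is needed because a germ chosen so far must be joined to a prescribed extension of
    its restriction to a smaller stable set; if the two overlapped further, they could demand
    contradictory values. The tree separates cosets because f_t = f_s h with h in H gives f_t^-1 p_i
    f_t = h^-1 (f_s^-1 p_i f_s) h, so the coset of f_s determines every s_i. The entries p_i must
    therefore be common to all branches, which is what conjugacy of generic tuples achieves. *)

Section Predimension.
Variables (V : eqType) (R : rel V) (mm : nat).
Hypothesis HR : graph_rel R.
Implicit Types A B P Q : seq V.

Definition degsum A : nat := \sum_(x <- undup A) \sum_(y <- undup A) (R x y : nat).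

Definition interseq A B : seq V := [seq x <- A | x \in B].

Lemma mem_interseq A B x : (x \in interseq A B) = (x \in A) && (x \in B).
Proof. by rewrite mem_filter andbC. Qed.

Lemma perm_undup_filter U A : uniq U -> {subset A <= U} ->
  perm_eq (undup A) [seq x <- U | x \in A].
Proof.
move=> uU sAU; apply: uniq_perm; rewrite ?undup_uniq ?filter_uniq //.
move=> x; rewrite mem_undup mem_filter; case xA: (x \in A) => //=.
by rewrite sAU.
Qed.

(** Indicator sums over one ambient list let several sets be compared summand by summand. *)
Lemma degsumE U A : uniq U -> {subset A <= U} ->
  degsum A = \sum_(x <- U) \sum_(y <- U) ((x \in A) && (y \in A) && R x y : nat).
Proof.
move=> uU sAU; have pA := perm_undup_filter uU sAU.
rewrite /degsum (perm_big _ pA) /= big_filter big_mkcond /=.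
apply: eq_bigr => x _; case: (x \in A) => /=; last by rewrite big1.
rewrite (perm_big _ pA) /= big_filter big_mkcond /=.
by apply: eq_bigr => y _; case: (y \in A).
Qed.

Lemma fcardE U A : uniq U -> {subset A <= U} ->
  Defs.fcard A = \sum_(x <- U) (x \in A : nat).
Proof.
move=> uU sAU; have pA := perm_undup_filter uU sAU.
rewrite /Defs.fcard (perm_size pA) size_filter -sum1_count big_mkcond /=.
by apply: eq_bigr => x _; case: (x \in A).
Qed.

(** A new vertex contributes its degree twice, by symmetry and the zero diagonal. Parity makes the
    truncated division in [nedges] exact. *)
Lemma odd_degsum A : odd (degsum A) = false.
Proof.
case: HR => irrR symR; rewrite /degsum.
elim: (undup A) => [|x s IH]; first by rewrite big_nil.
rewrite !big_cons irrR add0n.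
under [X in _ + X]eq_bigr => y _ do rewrite big_cons symR.
by rewrite big_split /= !oddD IH addbF addbb.
Qed.

Lemma nedges_double A : (nedges R A).*2 = degsum A.
Proof.
have := odd_double_half (degsum A); rewrite odd_degsum add0n => dE.
by rewrite /nedges divn2 -[X in X./2]dE doubleK.
Qed.

Lemma delta_double A :
  (delta R mm A * 2 = ((mm * Defs.fcard A).*2)%:Z - (degsum A)%:Z)%R.
Proof. by rewrite /delta -nedges_double; lia. Qed.

Lemma eq_delta A B : A =i B -> delta R mm A = delta R mm B.
Proof.
move=> eAB; have pe : perm_eq (undup A) (undup B).
  by apply: uniq_perm; rewrite ?undup_uniq // => x; rewrite !mem_undup.
rewrite /delta /Defs.fcard /nedges (perm_size pe) (perm_big _ pe) /=.
by under eq_bigr => x _ do rewrite (perm_big _ pe).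
Qed.

(** Fixing which endpoint lies in [P] counts each edge once, although the sum runs over ordered
    pairs. *)
Definition crossedges P Q : nat :=
  \sum_(x <- undup (P ++ Q)) \sum_(y <- undup (P ++ Q))
    [&& x \in P, x \notin Q, y \in Q, y \notin P & R x y].

(** The union sees, beyond the edges of [P] and [Q], exactly those between the two differences.
    Keeping this defect exact lets equality in submodularity exclude such edges. *)
Lemma delta_modular P Q :
  (delta R mm (P ++ Q) + delta R mm (interseq P Q) + (crossedges P Q)%:Z =
   delta R mm P + delta R mm Q)%R.
Proof.
set U := undup (P ++ Q); have uU : uniq U by apply: undup_uniq.
have sPQ : {subset P ++ Q <= U} by move=> x; rewrite mem_undup.
have sP : {subset P <= U} by move=> x xP; rewrite mem_undup mem_cat xP.
have sQ : {subset Q <= U} by move=> x xP; rewrite mem_undup mem_cat xP orbT.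
have sI : {subset interseq P Q <= U}
  by move=> x; rewrite mem_interseq => /andP[/sP].
have := delta_double P; have := delta_double Q.
have := delta_double (P ++ Q); have := delta_double (interseq P Q).
rewrite (fcardE uU sPQ) (fcardE uU sP) (fcardE uU sQ) (fcardE uU sI).
rewrite (degsumE uU sPQ) (degsumE uU sP) (degsumE uU sQ) (degsumE uU sI).
have cardE : \sum_(x <- U) (x \in P ++ Q : nat) +
  \sum_(x <- U) (x \in interseq P Q : nat) =
  \sum_(x <- U) (x \in P : nat) + \sum_(x <- U) (x \in Q : nat).
  rewrite -!big_split /=; apply: eq_bigr => x _.
  by rewrite mem_cat mem_interseq; case: (x \in P); case: (x \in Q).
have crossC : \sum_(x <- U) \sum_(y <- U)
    ([&& x \in Q, x \notin P, y \in P, y \notin Q & R x y] : nat) = crossedges P Q.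
  rewrite exchange_big /=; apply: eq_bigr => x _; apply: eq_bigr => y _.
  case: HR => _ symR; rewrite symR.
  by case: (x \in P); case: (x \in Q); case: (y \in P); case: (y \in Q).
have degE : \sum_(x <- U) \sum_(y <- U)
     ((x \in P ++ Q) && (y \in P ++ Q) && R x y : nat) +
  \sum_(x <- U) \sum_(y <- U)
     ((x \in interseq P Q) && (y \in interseq P Q) && R x y : nat) =
  \sum_(x <- U) \sum_(y <- U) ((x \in P) && (y \in P) && R x y : nat) +
  \sum_(x <- U) \sum_(y <- U) ((x \in Q) && (y \in Q) && R x y : nat) +
  (crossedges P Q).*2.
  rewrite -addnn -{2}crossC addnA /crossedges -!big_split /=.
  apply: eq_bigr => x _; rewrite -!big_split /=; apply: eq_bigr => y _.
  rewrite !mem_cat !mem_interseq.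
  by case: (x \in P); case: (x \in Q); case: (y \in P); case: (y \in Q);
     case: (R x y).
move: cardE degE; move: (\sum_(x <- U) _) => c1; move: (\sum_(x <- U) _) => c2.
move: (\sum_(x <- U) _) => c3; move: (\sum_(x <- U) _) => c4.
move: (\sum_(x <- U) _) => c5; move: (\sum_(x <- U) _) => c6.
move: (\sum_(x <- U) _) => c7; move: (\sum_(x <- U) _) => c8.
rewrite /U -/U; move=> e1 e2.
have : (mm * c1 + mm * c2 = mm * c3 + mm * c4)%N by rewrite -!mulnDr e1.
lia.
Qed.

Lemma delta_submodular P Q :
  (delta R mm (P ++ Q) + delta R mm (interseq P Q) <=
   delta R mm P + delta R mm Q)%R.
Proof. by have := delta_modular P Q; lia. Qed.

Lemma crossedges0 P Q x y : crossedges P Q = 0 ->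
  x \in P -> x \notin Q -> y \in Q -> y \notin P -> R x y = false.
Proof.
move=> c0 xP xQ yQ yP; apply/negP => Rxy.
have xU : x \in undup (P ++ Q) by rewrite mem_undup mem_cat xP.
have yU : y \in undup (P ++ Q) by rewrite mem_undup mem_cat yQ orbT.
move: c0; rewrite /crossedges (bigD1_seq x) ?undup_uniq //=.
rewrite (bigD1_seq y) ?undup_uniq //=.
by rewrite xP xQ yQ yP Rxy.
Qed.

Lemma crossedges_eq0 P Q :
  (forall x y, x \in P -> x \notin Q -> y \in Q -> y \notin P -> R x y = false) ->
  crossedges P Q = 0.
Proof.
move=> nR; rewrite /crossedges big1 // => x _; rewrite big1 // => y _.
case xP: (x \in P) => //; case xQ: (x \in Q) => //.
by case yQ: (y \in Q) => //; case yP: (y \in P) => //=; rewrite nR ?xP ?xQ ?yQ ?yP.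
Qed.

Lemma delta_cons y A : y \notin A ->
  (delta R mm (y :: A) = delta R mm A + mm%:Z - (count (R y) (undup A))%:Z)%R.
Proof.
move=> yA; have [irrR symR] := HR.
have := delta_double (y :: A); have := delta_double A.
have -> : Defs.fcard (y :: A) = (Defs.fcard A).+1 by rewrite /Defs.fcard /= (negPf yA).
have -> : degsum (y :: A) = degsum A + (count (R y) (undup A)).*2.
  rewrite /degsum /= (negPf yA) !big_cons irrR add0n.
  under [X in _ + X = _]eq_bigr => x _ do rewrite big_cons symR.
  rewrite big_split /= addnA addnn addnC; congr (_ + _.*2).
  by rewrite -sum1_count [RHS]big_mkcond; apply: eq_bigr => x _; case: (R y x).
by rewrite mulnS; lia.
Qed.

Lemma delta_nil : delta R mm [::] = 0%R.
Proof. by rewrite /delta /Defs.fcard /nedges /= big_nil muln0 div0n. Qed.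

End Predimension.

Lemma delta_map (V W : eqType) (R : rel V) (S : rel W) (mm : nat) (h : V -> W) A :
  {in A &, injective h} -> {in A &, forall x y, S (h x) (h y) = R x y} ->
  delta S mm (map h A) = delta R mm A.
Proof.
move=> hi hR.
have pe : perm_eq (undup (map h A)) (map h (undup A)).
  apply: uniq_perm; rewrite ?undup_uniq //.
    rewrite map_inj_in_uniq ?undup_uniq // => x y.
    by rewrite !mem_undup; apply: hi.
  by move=> x; rewrite mem_undup (eq_mem_map h (mem_undup A)).
have e1 : Defs.fcard (map h A) = Defs.fcard A by rewrite /Defs.fcard (perm_size pe) size_map.
rewrite /delta e1 /nedges; congr (_ - Posz (_ %/ 2))%R.
rewrite (perm_big _ pe) /= big_map big_seq [RHS]big_seq.
apply: eq_bigr => x; rewrite mem_undup => xA.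
rewrite (perm_big _ pe) /= big_map big_seq [RHS]big_seq.
by apply: eq_bigr => y; rewrite mem_undup => yA; rewrite hR.
Qed.

(** * Automorphisms and generic chains *)

Section Automorphisms.
Variables (T : Type) (R : rel T).
Implicit Types g h : T -> T.

(* Junk value: [g] itself when [g] is not bijective. *)
Definition inverse g : T -> T :=
  if pselect (exists g', cancel g g' /\ cancel g' g) is left e
  then projT1 (cid e) else g.

Lemma inverseP g : is_aut R g -> cancel g (inverse g) /\ cancel (inverse g) g.
Proof.
move=> [[g' gK g'K] _]; rewrite /inverse; case: pselect => [e|[]].
  exact: projT2 (cid e).
by exists g'.
Qed.

Lemma autK g : is_aut R g -> cancel g (inverse g).
Proof. by case/inverseP. Qed.

Lemma autVK g : is_aut R g -> cancel (inverse g) g.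
Proof. by case/inverseP. Qed.

Lemma aut_inj g : is_aut R g -> injective g.
Proof. by move=> /autK/can_inj. Qed.

Lemma aut_id : is_aut R id.
Proof. by split=> //; exists id. Qed.

Lemma aut_comp g h : is_aut R g -> is_aut R h -> is_aut R (g \o h).
Proof.
move=> [bg eg] [bh eh]; split; first exact: bij_comp.
by move=> x y; rewrite /= eg eh.
Qed.

Lemma aut_inverse g : is_aut R g -> is_aut R (inverse g).
Proof.
move=> ag; have [gK gVK] := inverseP ag; split; first by exists g.
by move=> x y; case: ag => _ <-; rewrite !gVK.
Qed.

Lemma inverse_eq g x y : is_aut R g -> g x = y -> inverse g y = x.
Proof. by move=> ag <-; rewrite autK. Qed.

(** Two points always share a domain, so injectivity and edges pass to the limit; surjectivity does
    not, hence the last hypothesis. *)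
Lemma aut_limit (dom : nat -> T -> Prop) (f : nat -> T -> T) :
  (forall n, is_aut R (f n)) ->
  (forall n x, dom n x -> dom n.+1 x /\ f n.+1 x = f n x) ->
  (forall x, exists n, dom n x) ->
  (forall y, exists n x, dom n x /\ f n x = y) ->
  exists c, is_aut R c /\ forall n x, dom n x -> c x = f n x.
Proof.
move=> af fS dT rT.
have mono m n x : m <= n -> dom m x -> dom n x /\ f n x = f m x.
  move=> lemn dm; elim: n lemn => [|n IH].
    by rewrite leqn0 => /eqP <-.
  rewrite leq_eqVlt => /predU1P[<- //|]; rewrite ltnS => /IH[dn <-].
  exact: fS.
have coh m n x : dom m x -> dom n x -> f m x = f n x.
  move=> dm dn; case: (leqP m n) => [|/ltnW] le.
    by case: (mono _ _ _ le dm).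
  by case: (mono _ _ _ le dn).
pose c x := f (projT1 (cid (dT x))) x.
have cE n x : dom n x -> c x = f n x.
  by move=> dn; rewrite /c; case: cid => m dm /=; apply: coh dm dn.
have both x y : exists n, dom n x /\ dom n y.
  case: (dT x) => m dm; case: (dT y) => n dn; exists (maxn m n); split.
    by case: (mono _ _ _ (leq_maxl m n) dm).
  by case: (mono _ _ _ (leq_maxr m n) dn).
have rT' y : exists x, c x = y.
  by case: (rT y) => n [x [dn <-]]; exists x; apply: cE.
pose c' y := projT1 (cid (rT' y)).
have cK' : cancel c' c by move=> y; rewrite /c'; case: cid.
have ci : injective c.
  move=> x y; case: (both x y) => n [dx dy].
  by rewrite (cE n x) // (cE n y) //; apply: aut_inj.
exists c; split=> //; split.
  by exists c' => // x; apply: ci; rewrite cK'.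
move=> x y; case: (both x y) => n [dx dy].
by rewrite (cE n x) // (cE n y) //; case: (af n).
Qed.

End Automorphisms.

(** The meeting of countably many dense sets. The task with code [n] is met at stage [n.+1]; whether
    it stays met depends on [le]. *)
Lemma generic_chain (S : Type) (I : countType) (Inv : S -> Prop)
    (le : S -> S -> Prop) (task : I -> S -> Prop) (s0 : S) :
  (forall s, le s s) -> (forall s t u, le s t -> le t u -> le s u) ->
  (forall i s, Inv s -> exists t, [/\ Inv t, le s t & task i t]) -> Inv s0 ->
  exists u : nat -> S, [/\ u 0 = s0, forall n, Inv (u n),
    forall m n, m <= n -> le (u m) (u n) & forall i, exists n, task i (u n)].
Proof.
move=> lexx letr dense I0.
(* The invariant sits inside the existential so that choice yields a step function defined on all
   states. *)
have next n s : exists t, Inv s ->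
    [/\ Inv t, le s t & forall i, unpickle n = Some i -> task i t].
  case: (pselect (Inv s)) => [Is|nI]; last by exists s => /nI.
  case e: (unpickle n) => [i|]; last by exists s.
  case: (dense i s Is) => t [It lst tit]; exists t; split=> // j [<-].
  by [].
pose nx n s := projT1 (cid (next n s)).
have nxP n s : Inv s -> [/\ Inv (nx n s), le s (nx n s) &
    forall i, unpickle n = Some i -> task i (nx n s)].
  by rewrite /nx; case: cid.
pose fix u n := if n is m.+1 then nx m (u m) else s0.
have Iu n : Inv (u n) by elim: n => //= n /(nxP n) [].
exists u; split=> //.
  move=> m n; elim: n => [|n IH]; first by rewrite leqn0 => /eqP ->.
  rewrite leq_eqVlt => /predU1P[-> //|]; rewrite ltnS => /IH lmn.
  by apply: (letr _ _ _ lmn); case: (nxP n _ (Iu n)).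
move=> i; exists (pickle i).+1 => /=.
by case: (nxP (pickle i) _ (Iu (pickle i))) => _ _ H; apply: H; rewrite pickleK.
Qed.

(** * Closed and tight sets in the generic graph *)

Section GenericStructure.
Variables (mm : nat) (T : countType) (R : rel T).
Hypothesis HM : is_generic mm R.
Implicit Types (A B C D E F P Q : seq T) (g a b : T -> T).

Local Notation δ := (delta R mm).
Local Notation closed := (closed_in R mm).
Local Notation aut := (is_aut R).

Let HR : graph_rel R. Proof. by case: HM. Qed.

Let modular P Q :
  (δ (P ++ Q) + δ (interseq P Q) + (crossedges R P Q)%:Z = δ P + δ Q)%R.
Proof. exact: delta_modular. Qed.

Let submodular P Q : (δ (P ++ Q) + δ (interseq P Q) <= δ P + δ Q)%R.
Proof. exact: delta_submodular. Qed.

Let delta_consE y A : y \notin A ->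
  (δ (y :: A) = δ A + mm%:Z - (count (R y) (undup A))%:Z)%R.
Proof. exact: delta_cons. Qed.

Lemma closedP A : closed A <-> forall B, {subset A <= B} -> (δ A <= δ B)%R.
Proof.
split=> [cA B sAB|dA B sAB]; first by case: (cA B sAB) => _; apply.
by split=> // A' sA' _; apply: dA.
Qed.

Lemma eq_closed A B : A =i B -> closed A -> closed B.
Proof.
move=> eAB /closedP cA; apply/closedP => C sBC; rewrite -(eq_delta R mm eAB).
by apply: cA => x; rewrite eAB; apply: sBC.
Qed.

(** Universality for the graph without vertices. It yields [delta_ge0]: every finite subgraph of the
    generic graph has nonnegative predimension. *)
Lemma closed_nil : closed [::].
Proof.
case: HM => _ [_ [_ univ]].
case: (univ 0 (fun _ _ => false)) => [|f [_ [_]]].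
  split; first by split.
  move=> A'; suff -> : A' = [::] by rewrite delta_nil.
  by case: A' => // -[].
by rewrite (_ : enum 'I_0 = [::]) //; apply: size0nil; rewrite size_enum_ord.
Qed.

Lemma delta_ge0 A : (0 <= δ A)%R.
Proof. by have /closedP/(_ A) := closed_nil; rewrite delta_nil; apply. Qed.

Lemma closed_cover F : exists2 C, closed C & {subset F <= C}.
Proof.
case: HM => _ [[C [cC [CS CT]]] _].
have mono m n : m <= n -> {subset C m <= C n}.
  elim: n => [|n IH]; first by rewrite leqn0 => /eqP ->.
  rewrite leq_eqVlt => /predU1P[-> //|]; rewrite ltnS => /IH sm x /sm.
  exact: CS.
suff [n sF] : exists n, {subset F <= C n} by exists (C n).
elim: F => [|x F [n sF]]; first by exists 0.
case: (CT x) => m xm; exists (maxn m n) => y; rewrite inE => /predU1P[->|/sF].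
  exact: mono (leq_maxl m n) _ xm.
exact: mono (leq_maxr m n) _.
Qed.

Lemma closed_interseq_le P B : closed P -> (δ (interseq B P) <= δ B)%R.
Proof.
move=> /closedP/(_ (B ++ P)) cP; have := submodular B P.
have : (δ P <= δ (B ++ P))%R by apply: cP => x xP; rewrite mem_cat xP orbT.
lia.
Qed.

Lemma closed_interseq P Q : closed P -> closed Q -> closed (interseq P Q).
Proof.
move=> cP cQ; apply/closedP => B sB.
have := closed_interseq_le B cP; have := closed_interseq_le (interseq B P) cQ.
rewrite (@eq_delta _ R mm (interseq (interseq B P) Q) (interseq P Q)); first lia.
move=> x; rewrite !mem_interseq; case xP: (x \in P); rewrite ?andbF //=.
case xQ: (x \in Q); rewrite ?andbF //=.
by rewrite sB // mem_interseq xP xQ.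
Qed.

Lemma crossedges_eq0_delta P Q :
  (δ P + δ Q <= δ (P ++ Q) + δ (interseq P Q))%R -> crossedges R P Q = 0.
Proof. by have := modular P Q; lia. Qed.

(* Equivalently, A ⊆ D and δ(D) = d(A). *)
Definition tight A D :=
  {subset A <= D} /\ forall B, {subset A <= B} -> (δ D <= δ B)%R.

Lemma tight_closed A D : tight A D -> closed D.
Proof. by case=> sAD mD; apply/closedP => B sDB; apply: mD => x /sAD/sDB. Qed.

(** Descent on the predimension, a nonnegative integer. *)
Lemma tight_exists A : exists D, tight A D.
Proof.
suff H : forall k B, {subset A <= B} -> (δ B <= k%:Z)%R -> exists D, tight A D.
  by apply: (H `|δ A|%N A) => //; lia.
elim=> [|k IH] B sAB dB.
  by exists B; split=> // C _; have := delta_ge0 C; lia.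
case: (pselect (exists2 C, {subset A <= C} & (δ C <= k%:Z)%R)).
  by case=> C sAC dC; apply: IH dC.
move=> nC; exists B; split=> // C sAC; rewrite leNgt; apply/negP => ltC.
by apply: nC; exists C => //; lia.
Qed.

Lemma tight_delta A D D' : tight A D -> tight A D' -> δ D = δ D'.
Proof.
by case=> sD mD [sD' mD']; have := mD _ sD'; have := mD' _ sD; lia.
Qed.

Lemma tight_le A D D' : tight A D -> {subset A <= D'} -> (δ D' <= δ D)%R ->
  tight A D'.
Proof. by case=> _ mD sD' leD; split=> // B /mD; lia. Qed.

(** The intersection contains [A], so its predimension is at least that of [D]; the union has at
    least that of [E]. Submodularity makes both equalities, and the modular defect vanishes. *)
Lemma tight_cat_closed A E D : closed E -> {subset A <= E} -> tight A D ->
  [/\ closed (E ++ D), δ (E ++ D) = δ E & crossedges R E D = 0].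
Proof.
move=> /closedP cE sAE [sAD mD].
have dI : (δ D <= δ (interseq E D))%R.
  by apply: mD => x xA; rewrite mem_interseq sAE ?sAD.
have dU : (δ E <= δ (E ++ D))%R by apply: cE => x xE; rewrite mem_cat xE.
have dS := submodular E D.
split; [|lia|by apply: crossedges_eq0_delta; lia].
apply/closedP => B sB; apply: (@le_trans _ _ (δ E)); first lia.
by apply: cE => x xE; apply: sB; rewrite mem_cat xE.
Qed.

(* [sm A] is gcl(A), as the directed union of the tight sets of A. *)
Definition sm A x := exists2 D, tight A D & x \in D.

Lemma tight_cat A D D' : tight A D -> tight A D' -> tight A (D ++ D').
Proof.
move=> tD tD'; have cD := tight_closed tD.
have [_ dE _] := tight_cat_closed cD (proj1 tD) tD'.
apply: (tight_le tD); last by rewrite dE.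
by move=> x /(proj1 tD); rewrite mem_cat => ->.
Qed.

Lemma tight_sm A D x : tight A D -> x \in D -> sm A x.
Proof. by exists D. Qed.

Lemma sm_cover A F : (forall x, x \in F -> sm A x) ->
  exists2 D, tight A D & {subset F <= D}.
Proof.
elim: F => [|x F IH] sF; first by case: (tight_exists A) => D; exists D.
have [|D tD sD] := IH; first by move=> y yF; apply: sF; rewrite inE yF orbT.
case: (sF x (mem_head _ _)) => D' tD' xD'.
exists (D ++ D'); first exact: tight_cat.
by move=> y; rewrite inE mem_cat => /predU1P[->|/sD -> //]; rewrite xD' orbT.
Qed.

Lemma sm_cover2 A D F : tight A D -> (forall x, x \in F -> sm A x) ->
  exists D', [/\ tight A D', {subset D <= D'} & {subset F <= D'}].
Proof.
move=> tD sF; have [|D' tD' sD'] := @sm_cover A (D ++ F).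
  by move=> x; rewrite mem_cat => /orP[|/sF //]; apply: tight_sm.
by exists D'; split=> // x xD; apply: sD'; rewrite mem_cat xD ?orbT.
Qed.

Lemma sm_ext A x : x \in A -> sm A x.
Proof. by case: (tight_exists A) => D tD xA; exists D => //; apply: (proj1 tD). Qed.

Lemma sm_closure A B x : (forall y, y \in A -> sm B y) -> sm A x -> sm B x.
Proof.
move=> sAB [D tD xD]; have [D' tD' sD'] := sm_cover sAB.
have [_ dE _] := tight_cat_closed (tight_closed tD') sD' tD.
exists (D' ++ D); last by rewrite mem_cat xD orbT.
apply: (tight_le tD'); last by rewrite dE.
by move=> y /(proj1 tD'); rewrite mem_cat => ->.
Qed.

Definition smpart A E := [seq x <- E | `[< sm A x >]].

Lemma mem_smpart A E x : x \in smpart A E <-> x \in E /\ sm A x.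
Proof.
rewrite mem_filter; split=> [/andP[/asboolP]|[xE sx]] //.
by rewrite xE andbT; apply/asboolP.
Qed.

(** This part is the trace on [E] of some tight set of [A], and a closed set cuts without raising
    the predimension. *)
Lemma tight_smpart A E : closed E -> {subset A <= E} -> tight A (smpart A E).
Proof.
move=> cE sAE; have [|D tD sD] := @sm_cover A (smpart A E).
  by move=> x /mem_smpart[].
have sA : {subset A <= smpart A E}.
  by move=> x xA; apply/mem_smpart; split; [apply: sAE|apply: sm_ext].
apply: (tight_le tD sA).
rewrite (@eq_delta _ R mm (smpart A E) (interseq D E)).
  exact: closed_interseq_le.
move=> x; rewrite mem_interseq; apply/idP/andP => [xs|[xD xE]].
  by split; [apply: sD|case/mem_smpart: xs].
by apply/mem_smpart; split=> //; apply: tight_sm xD.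
Qed.

(** * Gluing automorphisms along tight sets *)

Lemma aut_delta g A : aut g -> δ (map g A) = δ A.
Proof.
move=> ag; apply: delta_map; last by move=> x y _ _; case: ag.
by move=> x y _ _; apply: (aut_inj ag).
Qed.

Lemma map_inverseK g A : aut g -> map g (map (inverse g) A) = A.
Proof. by move=> ag; rewrite -map_comp map_id_in // => x _ /=; rewrite (autVK ag). Qed.

Lemma inverse_mapK g A : aut g -> map (inverse g) (map g A) = A.
Proof. by move=> ag; rewrite -map_comp map_id_in // => x _ /=; rewrite (autK ag). Qed.

Lemma tight_map g A D : aut g -> tight A D -> tight (map g A) (map g D).
Proof.
move=> ag [sD mD]; split=> [_ /mapP[x xA ->]|B sB].
  by apply: map_f; apply: sD.
rewrite aut_delta // -(map_inverseK B ag) aut_delta //; apply: mD => x xA.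
by rewrite -(autK ag x); apply: map_f; apply: sB; apply: map_f.
Qed.

Lemma closed_map g A : aut g -> closed A -> closed (map g A).
Proof.
move=> ag /closedP cA; have : tight A A by split.
by move=> /(tight_map ag)/tight_closed.
Qed.

Lemma sm_map g A x : aut g -> sm (map g A) (g x) <-> sm A x.
Proof.
move=> ag; split=> -[D tD xD].
  exists (map (inverse g) D); last by rewrite -(autK ag x) map_f.
  by rewrite -(inverse_mapK A ag); apply: tight_map tD; apply: aut_inverse.
by exists (map g D); [apply: tight_map|apply: map_f].
Qed.

(** With no cross edges before or after the maps, the union of the restrictions is an isomorphism of
    finite closed sets, and homogeneity extends it. *)
Lemma glue_autos P Q g a : aut g -> aut a ->
  (forall x, x \in P -> x \in Q -> g x = a x) ->
  (forall x y, x \in P -> y \in Q -> g x = a y -> x \in Q) ->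
  closed (P ++ Q) -> closed (map g P ++ map a Q) ->
  crossedges R P Q = 0 -> crossedges R (map g P) (map a Q) = 0 ->
  exists h, [/\ aut h, {in P, h =1 g} & {in Q, h =1 a}].
Proof.
move=> ag aa ega disj c1 c2 x1 x2; have [irrR symR] := HR.
pose h x := if x \in P then g x else a x.
have hP : {in P, h =1 g} by move=> x xP; rewrite /h xP.
have hQ : {in Q, h =1 a}.
  by move=> x xQ; rewrite /h; case: ifP => // xP; apply: ega.
have gQ x y : x \in P -> y \in Q -> (g x == a y) = (x == y).
  move=> xP yQ; apply/eqP/eqP => [e|e]; last by rewrite -e ega // e.
  by apply: (aut_inj aa); rewrite -e ega //; apply: disj e.
have hR' x y : x \in P -> y \in Q -> R (g x) (a y) = R x y.
  move=> xP yQ; case xQ: (x \in Q); first by rewrite ega //; case: aa.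
  case yP: (y \in P); first by rewrite -ega //; case: ag.
  rewrite (@crossedges0 _ _ _ _ x y x1) ?xQ ?yP //; apply: (crossedges0 x2).
  - exact: map_f.
  - apply/negP => /mapP[z zQ e]; move/eqP: (e); rewrite gQ // => /eqP exz.
    by rewrite exz zQ in xQ.
  - exact: map_f.
  - apply/negP => /mapP[z zP e]; move/esym/eqP: (e); rewrite gQ // => /eqP exz.
    by rewrite -exz zP in yP.
case: HM => _ [_ [hom _]].
have [||||k [ak kE]] := hom _ _ h c1 c2.
- move=> x y; rewrite !mem_cat => /orP[xP|xQ] /orP[yP|yQ].
  + by rewrite !hP //; apply: (aut_inj ag).
  + by rewrite hP // hQ // => /eqP; rewrite gQ // => /eqP.
  + by rewrite hQ // hP // => /esym/eqP; rewrite gQ // => /eqP.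
  + by rewrite !hQ //; apply: (aut_inj aa).
- move=> x; rewrite !mem_cat => /orP[xP|xQ].
    by rewrite hP // map_f.
  by rewrite hQ // map_f // orbT.
- move=> y; rewrite mem_cat => /orP[] /mapP[x xS ->]; exists x.
  + by rewrite mem_cat xS.
  + exact: hP.
  + by rewrite mem_cat xS orbT.
  + exact: hQ.
- move=> x y; rewrite !mem_cat => /orP[xP|xQ] /orP[yP|yQ].
  + by rewrite !hP //; case: ag.
  + by rewrite hP // hQ // hR'.
  + by rewrite hQ // hP // symR hR' // symR.
  + by rewrite !hQ //; case: aa.
exists k; split=> // x xS; rewrite kE ?mem_cat ?xS ?orbT //.
  exact: hP.
exact: hQ.
Qed.

Lemma glue_tight A E D g a : aut g -> aut a -> closed E -> {subset A <= E} ->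
  tight A D -> (forall x, x \in E -> sm A x -> x \in D /\ g x = a x) ->
  exists h, [/\ aut h, {in E, h =1 g} & {in D, h =1 a}].
Proof.
move=> ag aa cE sAE tD eD.
have [c1 _ x1] := tight_cat_closed cE sAE tD.
have smA x : x \in A -> sm A x by apply: sm_ext.
have gA : map g A = map a A.
  by apply/eq_in_map => x xA; case: (eD x) => //; [apply: sAE|apply: smA].
have sAE' : {subset map a A <= map g E}.
  by rewrite -gA => _ /mapP[x xA ->]; apply/map_f/sAE.
have [c2 _ x2] := tight_cat_closed (closed_map ag cE) sAE' (tight_map aa tD).
apply: glue_autos => //.
  by move=> x xE xD; case: (eD x) => //; apply: tight_sm xD.
move=> x y xE yD e; case: (eD x) => //; apply/(sm_map A x ag).
by rewrite gA e; apply/sm_map => //; apply: tight_sm yD.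
Qed.

(** A finite approximation to a common extension of [a] on [sm A] and [b] on [sm B]. Only the values
    of the automorphism [s.2] on [s.1] count; using a full automorphism makes inversion of states
    immediate. *)
Definition joint_state A B a b (s : seq T * (T -> T)) :=
  [/\ closed s.1, {subset A ++ B <= s.1}, aut s.2,
      forall x, x \in s.1 -> sm A x -> s.2 x = a x &
      forall x, x \in s.1 -> sm B x -> s.2 x = b x].

Definition state_le (s t : seq T * (T -> T)) :=
  {subset s.1 <= t.1} /\ {in s.1, t.2 =1 s.2}.

(** New points in [sm A] or [sm B] have prescribed images, so [g] is corrected on the [A] part of a
    larger closed set and then on its [B] part. *)
Lemma joint_forth A B a b s x : aut a -> aut b ->
  (forall y, sm A y -> sm B y -> a y = b y) -> joint_state A B a b s ->
  exists t, [/\ joint_state A B a b t, state_le s t & x \in t.1].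
Proof.
case: s => E g aa ab eab [/= cE sE ag gA gB].
have [E2 cE2 sE2] := closed_cover (x :: E).
have sEE : {subset E <= E2} by move=> y yE; apply: sE2; rewrite inE yE orbT.
have sA : {subset A <= E} by move=> y yA; apply: sE; rewrite mem_cat yA.
have sB : {subset B <= E} by move=> y yB; apply: sE; rewrite mem_cat yB orbT.
have tA := tight_smpart cE2 (fun y yA => sEE y (sA y yA)).
have tB := tight_smpart cE2 (fun y yA => sEE y (sB y yA)).
have [|h [ah hE hA]] := glue_tight ag aa cE sA tA.
  by move=> y yE sy; split; [apply/mem_smpart; split=> //; apply: sEE|apply: gA].
have [cEA _ _] := tight_cat_closed cE sA tA.
have [||k [ak kE kB]] := @glue_tight B (E ++ smpart A E2) _ h b ah ab cEA _ tB.
- by move=> y /sB; rewrite mem_cat => ->.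
- move=> y; rewrite mem_cat => /orP[yE|yA] sy.
    split; first by apply/mem_smpart; split=> //; apply: sEE.
    by rewrite hE // gB.
  split; first by apply/mem_smpart; split=> //; case/mem_smpart: yA.
  by rewrite hA // eab //; case/mem_smpart: yA.
exists (E2, k); split; last by apply: sE2; rewrite mem_head.
- split=> //=.
  + by move=> y /sE/sEE.
  + move=> y yE2 sy; have yA : y \in smpart A E2 by apply/mem_smpart.
    by rewrite kE ?mem_cat ?yA ?orbT // hA.
  + by move=> y yE2 sy; apply: kB; apply/mem_smpart.
- by split=> //= y yE; rewrite kE ?mem_cat ?yE // hE.
Qed.

Lemma joint_state_inverse A B a b E g : aut a -> aut b ->
  joint_state A B a b (E, g) ->
  joint_state (map a A) (map b B) (inverse a) (inverse b) (map g E, inverse g).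
Proof.
move=> aa ab [/= cE sE ag gA gB].
have eA : map a A = map g A.
  apply/eq_in_map => x xA; rewrite gA //; last exact: sm_ext.
  by apply: sE; rewrite mem_cat xA.
have eB : map b B = map g B.
  apply/eq_in_map => x xB; rewrite gB //; last exact: sm_ext.
  by apply: sE; rewrite mem_cat xB orbT.
split=> /=.
- exact: closed_map.
- by rewrite eA eB -map_cat => _ /mapP[x xS ->]; apply/map_f/sE.
- exact: aut_inverse.
- move=> _ /mapP[x xE ->]; rewrite eA => /(sm_map _ _ ag) sx.
  by rewrite {2}gA // !(autK (R := R)).
- move=> _ /mapP[x xE ->]; rewrite eB => /(sm_map _ _ ag) sx.
  by rewrite {2}gB // !(autK (R := R)).
Qed.

(** Back and forth. The condition on [a y = b z] becomes the agreement condition for the inverses,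
    as the back steps require. *)
Lemma joint_extension A B a b E g : aut a -> aut b ->
  (forall y, sm A y -> sm B y -> a y = b y) ->
  (forall y z, sm A y -> sm B z -> a y = b z -> y = z) ->
  joint_state A B a b (E, g) ->
  exists c, [/\ aut c, forall x, sm A x -> c x = a x,
    forall x, sm B x -> c x = b x & {in E, c =1 g}].
Proof.
move=> aa ab eab dis st0.
have le_refl s : state_le s s by split.
have le_tr s t u : state_le s t -> state_le t u -> state_le s u.
  move=> [s1 e1] [s2 e2]; split=> [x /s1/s2 //|x xs].
  by rewrite e2 ?e1 //; apply: s1.
have [aVa aVb] := (aut_inverse aa, aut_inverse ab).
have eab' y : sm (map a A) y -> sm (map b B) y -> inverse a y = inverse b y.
  move=> sA sB; have sA' : sm A (inverse a y) by rewrite -(sm_map _ _ aa) (autVK aa).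
  have sB' : sm B (inverse b y) by rewrite -(sm_map _ _ ab) (autVK ab).
  by apply: dis => //; rewrite (autVK aa) (autVK ab).
pose task (i : T + T) (s : seq T * (T -> T)) :=
  match i with inl x => x \in s.1 | inr y => y \in map s.2 s.1 end.
have [|u [u0 uS ule ut]] := generic_chain (task := task) le_refl le_tr _ st0.
  move=> [x|y] s ss; first exact: joint_forth.
  (* The back step is a forth step for the inverse state, inverted again. *)
  case: s ss => E1 g1 ss; have [_ _ ag1 _ _] := ss.
  have := joint_state_inverse aa ab ss.
  case/(joint_forth y aVa aVb eab') => -[F k] [st [/= le1 le2] yF].
  have /= ak : aut k by case: st.
  exists (map k F, inverse k); split.
  - have := joint_state_inverse aVa aVb st.
    rewrite !inverse_mapK //.
    rewrite (_ : inverse (inverse a) = a) 1?(_ : inverse (inverse b) = b) //.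
      by apply: funext => x; apply: (inverse_eq aVb); rewrite (autK ab).
    by apply: funext => x; apply: (inverse_eq aVa); rewrite (autK aa).
  - split=> /= x xE1.
      have -> : x = k (g1 x) by rewrite le2 ?map_f // (autK ag1).
      by apply: map_f; apply: le1; apply: map_f.
    by apply: (inverse_eq ak); rewrite le2 ?map_f // (autK ag1).
  - by rewrite /= inverse_mapK.
have [||||c [ac cE]] := @aut_limit _ R (fun n x => x \in (u n).1) (fun n => (u n).2).
- by move=> n; case: (uS n).
- by move=> n x xn; have [s1 e1] := ule n n.+1 (leqnSn n); rewrite s1 ?e1.
- by move=> x; case: (ut (inl x)) => n; exists n.
- by move=> y; case: (ut (inr y)) => n /mapP[x xn ->]; exists n, x.
exists c; split=> //.
- move=> x sx; case: (ut (inl x)) => n xn; rewrite (cE n) //.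
  by case: (uS n) => _ _ _ H _; apply: H.
- move=> x sx; case: (ut (inl x)) => n xn; rewrite (cE n) //.
  by case: (uS n) => _ _ _ _ H; apply: H.
- by move=> x xE; rewrite (cE 0) u0.
Qed.

Lemma tight_extension A E a g : aut a -> aut g -> closed E -> {subset A <= E} ->
  (forall x, x \in E -> sm A x -> g x = a x) ->
  exists c, [/\ aut c, forall x, sm A x -> c x = a x & {in E, c =1 g}].
Proof.
move=> aa ag cE sE ega.
have [|||c [ac cA _ cE']] := @joint_extension A A a a E g aa aa.
- by [].
- by move=> y z _ _; apply: (aut_inj aa).
- by split=> //= x; rewrite mem_cat orbb; apply: sE.
by exists c.
Qed.

(** * Realising finite extensions inside the generic graph *)

Lemma closed_trans C P : closed C -> {subset P <= C} ->
  (forall B, {subset P <= B} -> {subset B <= C} -> (δ P <= δ B)%R) -> closed P.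
Proof.
move=> cC sPC mP; apply/closedP => B sPB.
apply: le_trans (closed_interseq_le B cC); apply: mP => x; rewrite mem_interseq.
  by move=> xP; rewrite sPB ?sPC.
by case/andP.
Qed.

Lemma delta_clique n (s : seq 'I_n) : uniq s ->
  (delta (fun i j : 'I_n => i != j) mm s * 2 =
     (size s)%:Z * ((2 * mm).+1%:Z - (size s)%:Z))%R.
Proof.
have HK : graph_rel (fun i j : 'I_n => i != j).
  by split=> [i|i j]; rewrite ?eqxx // eq_sym.
elim: s => [|x s IH]; first by rewrite delta_nil.
case/andP=> xs us; rewrite delta_cons //.
have -> : count (fun j : 'I_n => x != j) (undup s) = size s.
  rewrite undup_id //; apply/eqP; rewrite -all_count; apply/allP => y ys.
  by apply: contraNneq xs => ->.
by have := IH us; rewrite /=; nia.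
Qed.

(** The complete graph on k vertices has predimension k (2 mm + 1 - k) / 2, which vanishes at k = 2
    mm + 1. Such a clique lies in every small set, even in gcl of the empty set. *)
Lemma closed_clique : exists C, [/\ closed C, δ C = 0%R & mm < size (undup C)].
Proof.
case: HM => _ [_ [_ univ]].
case: (univ (2 * mm).+1 (fun i j => i != j)) => [|f [fi [fR cf]]].
  split; first by split=> [i|i j]; rewrite ?eqxx // eq_sym.
  move=> A'; rewrite (@eq_delta _ _ _ A' (undup A')); last first.
    by move=> x; rewrite mem_undup.
  have := delta_clique (undup_uniq A').
  have : size (undup A') <= (2 * mm).+1.
    by rewrite -[X in _ <= X]card_ord -(card_uniqP (undup_uniq A')) max_card.
  move=> le dE; have : (0 <= delta (fun i j : 'I_(2 * mm).+1 => i != j) mm (undup A') * 2)%R.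
    by rewrite dE Num.Theory.mulr_ge0 // Num.Theory.subr_ge0 lez_nat.
  lia.
exists (map f (enum 'I_(2 * mm).+1)); split=> //.
  rewrite (delta_map (R := fun i j : 'I_(2 * mm).+1 => i != j)).
  - have := delta_clique (enum_uniq 'I_(2 * mm).+1).
    rewrite size_enum_ord GRing.subrr GRing.mulr0 => /eqP.
    by rewrite GRing.mulf_eq0 orbF => /eqP.
  - by move=> x y _ _; apply: fi.
  - by move=> x y _ _; apply: fR.
have uf : uniq (map f (enum 'I_(2 * mm).+1)) by rewrite map_inj_uniq ?enum_uniq.
by rewrite (undup_id uf) size_map size_enum_ord; lia.
Qed.

(** Universality embeds [L] somewhere as a closed set, and homogeneity moves the image of [D] back
    onto [D]. *)
Lemma realize (U : countType) (S : rel U) (L : seq U) (i : T -> U) D :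
  graph_rel S ->
  (forall B : seq U, {subset B <= L} -> (0 <= delta S mm B)%R) ->
  closed D -> {in D &, injective i} ->
  {in D &, forall x y, S (i x) (i y) = R x y} -> {subset map i D <= L} ->
  (forall B : seq U, {subset map i D <= B} -> {subset B <= L} ->
     (δ D <= delta S mm B)%R) ->
  exists f : U -> T, [/\ {in L &, injective f},
    {in L &, forall u v, R (f u) (f v) = S u v}, {in D, forall x, f (i x) = x} &
    forall P : seq U, {subset P <= L} ->
      (forall B : seq U, {subset P <= B} -> {subset B <= L} ->
        (delta S mm P <= delta S mm B)%R) -> closed (map f P)].
Proof.
move=> HS K0 cD ii iR sDL cDL; have [irrS symS] := HS.
(* A value for points outside [L]; the nonempty clique provides one. *)
have [t0 _] : exists t0 : T, True.
  have [[|t C] [_ _]] := closed_clique; first by [].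
  by exists t.
pose t := in_tuple (undup L); pose n := size (undup L).
pose S' (k l : 'I_n) := S (tnth t k) (tnth t l).
have tL k : tnth t k \in L by rewrite -mem_undup; apply: mem_tnth.
have ti : injective (tnth t) by apply/tuple_uniqP; apply: undup_uniq.
case: HM => _ [_ [hom univ]].
have [|f0 [f0i [f0R cf0]]] := univ n S'.
  split; first by split=> [k|k l]; rewrite /S' // symS.
  move=> B; rewrite -(@delta_map _ _ S' S mm (tnth t) B) //.
    by apply: K0 => _ /mapP[k _ ->].
  by move=> k l _ _; apply: ti.
have ex u : exists x : T, forall k, tnth t k = u -> x = f0 k.
  case: (pselect (exists k, tnth t k = u)) => [[k ek]|nk].
    by exists (f0 k) => l; rewrite -ek => /ti ->.
  by exists t0 => k ek; case: nk; exists k.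
pose f1 u := projT1 (cid (ex u)).
have f1E k : f1 (tnth t k) = f0 k.
  by rewrite /f1; case: cid => x /= H; apply: H.
have Lt u : u \in L -> exists k, u = tnth t k.
  by rewrite -mem_undup => /(@tnthP _ _ t).
have f1i : {in L &, injective f1}.
  by move=> _ _ /Lt[k ->] /Lt[l ->]; rewrite !f1E => /f0i ->.
have f1R : {in L &, forall u v, R (f1 u) (f1 v) = S u v}.
  by move=> _ _ /Lt[k ->] /Lt[l ->]; rewrite !f1E f0R.
have cf1 (P : seq U) : {subset P <= L} -> (forall B : seq U, {subset P <= B} -> {subset B <= L} ->
        (delta S mm P <= delta S mm B)%R) -> closed (map f1 P).
  move=> sPL mP; apply: (closed_trans cf0).
    by move=> _ /mapP[u /sPL/Lt[k ->] ->]; rewrite f1E map_f ?mem_enum.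
  move=> B sB sBC; pose B' := [seq u <- L | f1 u \in B].
  have sB' : {subset B' <= L} by move=> u; rewrite mem_filter => /andP[].
  have eB : B =i map f1 B'.
    move=> x; apply/idP/mapP => [xB|[u]]; last first.
      by rewrite mem_filter => /andP[uB _ ->].
    have /mapP[k _ ek] := sBC x xB; exists (tnth t k); last by rewrite f1E.
    by rewrite mem_filter f1E -ek xB tL.
  rewrite (eq_delta R mm eB) !(delta_map (R := S)).
  - apply: mP => // u uP; rewrite mem_filter sPL // andbT.
    by apply: sB; apply: map_f.
  - by move=> u v /sB' uL /sB' vL; apply: f1i.
  - by move=> u v /sB' uL /sB' vL; apply: f1R.
  - by move=> u v /sPL uL /sPL vL; apply: f1i.
  - by move=> u v /sPL uL /sPL vL; apply: f1R.
have iL x : x \in D -> i x \in L by move=> xD; apply/sDL/map_f.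
have dD : delta S mm (map i D) = δ D by apply: delta_map.
have cD1 : closed (map f1 (map i D)).
  by apply: cf1 => // B sB sBL; rewrite dD; apply: cDL.
have [||||h [ah hE]] := hom D _ (f1 \o i) cD cD1.
- by move=> x y xD yD /= /f1i e; apply: ii => //; apply: e; apply: iL.
- by move=> x xD; rewrite -map_comp map_f.
- by move=> y; rewrite -map_comp => /mapP[x xD ->]; exists x.
- by move=> x y xD yD /=; rewrite f1R ?iL // iR.
have ahV := aut_inverse ah.
exists (inverse h \o f1); split.
- by move=> u v uL vL /= /(aut_inj ahV); apply: f1i.
- by move=> u v uL vL /=; case: ahV => _ ->; apply: f1R.
- by move=> x xD /=; apply: (inverse_eq ah); rewrite hE.
- by move=> P sP mP; rewrite map_comp; apply: closed_map => //; apply: cf1.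
Qed.

Definition vertex_rel (N : seq T) (u v : option T) :=
  match u, v with
  | Some x, Some y => R x y
  | Some x, None => x \in N
  | None, Some y => y \in N
  | None, None => false
  end.

(** A vertex with at most [mm] neighbours never lowers the predimension, so the extension stays in
    K_0 and [C] stays closed in it. *)
Lemma realize_vertex C N : closed C -> {subset N <= C} -> uniq N ->
  size N <= mm ->
  exists y, [/\ y \notin C, {in C, forall x, R y x = (x \in N)} & closed (y :: C)].
Proof.
move=> cC sN uN szN; have [irrR symR] := HR.
pose S := vertex_rel N; pose L := None :: map some C.
have HS : graph_rel S.
  by split=> [[x|]|[x|] [y|]] //=; rewrite ?irrR ?symR // (symR y).
have dS (B : seq (option T)) : (δ (pmap id B) <= delta S mm B)%R.
  have dsome : delta S mm (map some (pmap id B)) = δ (pmap id B).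
    by apply: delta_map => // x y _ _ [].
  have mB x : (Some x \in map some (pmap id B)) = (Some x \in B).
    by rewrite mem_map ?mem_pmap ?map_id // => y z [].
  case NB: (None \in B).
    rewrite (@eq_delta _ S mm B (None :: map some (pmap id B))); last first.
      by move=> [x|]; rewrite inE ?mB ?NB.
    rewrite delta_cons //; last by apply/negP => /mapP[].
    rewrite dsome; set c := count _ _; suff : c <= mm by lia.
    apply: leq_trans szN; rewrite /c -size_filter -(size_map some N).
    apply: uniq_leq_size; first by rewrite filter_uniq ?undup_uniq.
    move=> [x|]; rewrite mem_filter //= => /andP[xN _]; exact: map_f.
  rewrite (@eq_delta _ S mm B (map some (pmap id B))) ?dsome //.
  by move=> [x|]; rewrite ?mB // NB; apply/esym/negP => /mapP[].
have sB (B : seq (option T)) : {subset map some C <= B} -> {subset C <= pmap id B}.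
  by move=> sCB x xC; rewrite mem_pmap map_id sCB // map_f.
have [|||||f [fi fR fE cf]] := @realize (option T) S L some C HS _ cC.
- by move=> B _; apply: le_trans (dS B); apply: delta_ge0.
- by move=> x y _ _ [].
- by [].
- by move=> u uC; rewrite inE uC orbT.
- by move=> B /sB sCB _; apply: le_trans (dS B); move/closedP: cC; apply.
have sC x : x \in C -> Some x \in L by move=> xC; rewrite inE map_f ?orbT.
exists (f None); split.
- apply/negP => fC; have := fE _ fC.
  by move/fi; rewrite sC // mem_head => /(_ isT isT).
- by move=> x xC; rewrite -{1}(fE x xC) fR ?mem_head ?sC.
- have -> : f None :: C = map f L.
    by rewrite /= -map_comp; congr (_ :: _); rewrite map_id_in.
  by apply: cf => // B s1 s2; rewrite (@eq_delta _ S mm L B) // => u; apply/idP/idP; [apply: s1|apply: s2].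
Qed.

(** Free amalgam over [K]: points of [K] are kept on the left only, so mixed edges must have their
    left end in [K]. *)
Definition amalgam_rel (K : seq T) (u v : T + T) :=
  match u, v with
  | inl x, inl y => R x y
  | inr x, inr y => R x y
  | inl x, inr y => R x y && (x \in K)
  | inr x, inl y => R x y && (y \in K)
  end.

(** In the amalgam δ(B) + δ(B ∩ K) = δ(B ∩ D) + δ(B ∩ F), and δ(B ∩ K) is at most either term on the
    right because [K] is closed. Hence the amalgam is in K_0 and both factors are closed in it. *)
Lemma realize_amalgam D F K : closed D -> closed F -> closed K ->
  {subset K <= D} -> {subset K <= F} ->
  exists q, [/\ aut q, {in K, forall x, q x = x},
    forall x, x \in F -> q x \in D -> x \in K, closed (D ++ map q F) &
    (δ (D ++ map q F) + δ K = δ D + δ F)%R].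
Proof.
move=> cD cF cK sKD sKF; have [irrR symR] := HR.
pose S := amalgam_rel K.
pose e x : T + T := if x \in K then inl x else inr x.
pose L := map (@inl T T) D ++ map e F.
have HS : graph_rel S.
  by split=> [[x|x]|[x|x] [y|y]] /=; rewrite ?irrR // symR.
have ei : {in F &, injective e}.
  by move=> x y _ _; rewrite /e; do 2!case: ifP => _ => // -[].
have eS : {in F &, forall x y, S (e x) (e y) = R x y}.
  move=> x y xF yF; rewrite /e /S; case: ifP => xK; case: ifP => yK //=.
    by rewrite xK andbT.
  by rewrite yK andbT.
pose B1 (B : seq (T + T)) := [seq x <- D | inl x \in B].
pose B2 (B : seq (T + T)) := [seq x <- F | e x \in B].
pose BK (B : seq (T + T)) := [seq x <- K | inl x \in B].
have B1E (B : seq (T + T)) x : (x \in B1 B) = (inl x \in B) && (x \in D) by rewrite mem_filter.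
have B2E (B : seq (T + T)) x : (x \in B2 B) = (e x \in B) && (x \in F) by rewrite mem_filter.
have BKE (B : seq (T + T)) x : (x \in BK B) = (inl x \in B) && (x \in K) by rewrite mem_filter.
have dS (B : seq (T + T)) : {subset B <= L} ->
  (delta S mm B + δ (BK B) = δ (B1 B) + δ (B2 B))%R.
  move=> sBL; have := delta_modular mm HS (map inl (B1 B)) (map e (B2 B)).
  rewrite (_ : crossedges _ _ _ = 0); last first.
    apply: crossedges_eq0 => _ _ /mapP[x xB ->] xn /mapP[y yB ->] yn /=.
    move: xB yB; rewrite B1E B2E => /andP[xB xD] /andP[yB yF].
    have xK : x \notin K.
      apply: contra xn => xK; apply/mapP; exists x; last by rewrite /e xK.
      by rewrite B2E /e xK xB sKF.
    rewrite /e; case: ifP => yK /=; last by rewrite (negPf xK) andbF.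
    case/negP: yn; rewrite /e yK map_f // B1E sKD // andbT.
    by move: yB; rewrite /e yK.
  have d1 : delta S mm (map inl (B1 B)) = δ (B1 B).
    by apply: delta_map => // x y _ _ [].
  have d2 : delta S mm (map e (B2 B)) = δ (B2 B).
    apply: delta_map => x y; rewrite !B2E => /andP[_ xF] /andP[_ yF].
      exact: ei.
    exact: eS.
  have d3 : delta S mm (map inl (BK B)) = δ (BK B).
    by apply: delta_map => // x y _ _ [].
  rewrite GRing.addr0 d1 d2 -d3 => <-; congr (_ + _)%R; apply: eq_delta => u.
    rewrite mem_cat; apply/idP/orP => [uB|].
      have := sBL u uB; rewrite mem_cat => /orP[] /mapP[x xS eu].
        by left; rewrite eu map_f // B1E -eu uB xS.
      by right; rewrite eu map_f // B2E -eu uB xS.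
    by case=> /mapP[x]; rewrite ?B1E ?B2E => /andP[xB _] ->.
  rewrite mem_interseq; apply/mapP/andP.
    case=> x; rewrite BKE => /andP[xB xK] ->; split.
      by rewrite map_f // B1E xB sKD.
    by apply/mapP; exists x; rewrite ?B2E /e xK // xB sKF.
  case=> /mapP[x xB ->] /mapP[y yB exy]; exists x => //.
  move: xB exy; rewrite BKE B1E /e => /andP[-> _] /=.
  by case: ifP => // yK [->].
have dS1 (B : seq (T + T)) : {subset B <= L} -> (δ (B1 B) <= delta S mm B)%R.
  move=> sBL; have := dS B sBL; have := closed_interseq_le (B2 B) cK.
  rewrite (@eq_delta _ R mm (interseq (B2 B) K) (BK B)); first lia.
  move=> x; rewrite mem_interseq BKE B2E /e.
  by case: ifP => xK; rewrite ?andbF // sKF // !andbT.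
have dS2 (B : seq (T + T)) : {subset B <= L} -> (δ (B2 B) <= delta S mm B)%R.
  move=> sBL; have := dS B sBL; have := closed_interseq_le (B1 B) cK.
  rewrite (@eq_delta _ R mm (interseq (B1 B) K) (BK B)); first lia.
  move=> x; rewrite mem_interseq BKE B1E.
  by case xK: (x \in K); rewrite ?andbF // sKD // !andbT.
have iL x : x \in D -> inl x \in L by move=> xD; rewrite mem_cat map_f.
have eL x : x \in F -> e x \in L by move=> xF; rewrite mem_cat map_f ?orbT.
have [|||||f [fi fR fE cf]] := @realize (T + T)%type S L inl D HS _ cD.
- by move=> B sB; apply: le_trans (dS1 B sB); apply: delta_ge0.
- by move=> x y _ _ [].
- by [].
- by move=> u uD; rewrite mem_cat uD.
- move=> B sDB sB; apply: le_trans (dS1 B sB); move/closedP: cD; apply.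
  by move=> x xD; rewrite B1E xD sDB ?map_f.
have cfF : closed (map f (map e F)).
  apply: cf => [_ /mapP[x xF ->]|B sFB sB]; first exact: eL.
  rewrite (delta_map (R := R)) //; apply: le_trans (dS2 B sB).
  by move/closedP: cF; apply=> x xF; rewrite B2E xF sFB ?map_f.
case: HM => _ [_ [hom _]].
have [||||q [aq qE]] := hom F _ (f \o e) cF cfF.
- by move=> x y xF yF /= /fi exy; apply: ei => //; apply: exy; apply: eL.
- by move=> x xF; rewrite -map_comp map_f.
- by move=> y; rewrite -map_comp => /mapP[x xF ->]; exists x.
- by move=> x y xF yF /=; rewrite fR ?eL // eS.
have qD x : x \in F -> q x \in D -> x \in K.
  move=> xF qxD; have := fE _ qxD; rewrite {2}(qE x xF) /= => /fi.
  by rewrite iL // eL // => /(_ isT isT); rewrite /e; case: ifP.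
have qK : {in K, forall x, q x = x}.
  by move=> x xK; rewrite qE ?sKF //= /e xK fE ?sKD.
have eqL : map f L = D ++ map q F.
  rewrite map_cat -!map_comp; congr (_ ++ _); first by rewrite map_id_in.
  by apply/eq_in_map => x xF; rewrite qE.
exists q; split=> //.
  rewrite -eqL; apply: cf => // B s1 s2.
  by rewrite (@eq_delta _ S mm L B) // => u; apply/idP/idP; [apply: s1|apply: s2].
have := modular D (map q F); rewrite aut_delta //.
rewrite (_ : crossedges _ _ _ = 0).
  rewrite GRing.addr0 => <-; congr (_ + _)%R; apply: eq_delta => x.
  rewrite mem_interseq; apply/idP/andP => [xK|[xD /mapP[y yF exy]]].
    by split; [apply: sKD|apply/mapP; exists x; rewrite ?qK ?sKF].
  have yK : y \in K by apply: qD; rewrite -?exy.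
  by rewrite exy qK.
apply: crossedges_eq0 => x _ xD xn /mapP[y yF ->] yn.
have yK : y \notin K by apply: contra yn => yK; rewrite qK // sKD.
have xK : x \notin K.
  by apply: contra xn => xK; apply/mapP; exists x; rewrite ?qK ?sKF.
by rewrite -(fE x xD) qE //= fR ?iL ?eL // /e (negPf yK) /= (negPf xK) andbF.
Qed.

(** * Extension and amalgamation of automorphisms of small sets *)

Lemma count_undup_le (Z N : seq T) y :
  (forall z, z \in Z -> R y z -> z \in N) -> count (R y) (undup Z) <= size N.
Proof.
move=> sN; rewrite -size_filter; apply: uniq_leq_size.
  by rewrite filter_uniq ?undup_uniq.
by move=> z; rewrite mem_filter mem_undup => /andP[Rz zZ]; apply: sN.
Qed.

Lemma count_undup_ge (Z N : seq T) y : uniq N ->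
  (forall z, z \in N -> z \in Z /\ R y z) -> size N <= count (R y) (undup Z).
Proof.
move=> uN sN; rewrite -size_filter; apply: uniq_leq_size => // z /sN[zZ Rz].
by rewrite mem_filter mem_undup zZ Rz.
Qed.

(* The new vertex is joined to a point outside sm D and to mm - 1 points of D:
   it is algebraic over V but has dimension one over D. *)
Lemma vertex_of_dim1 V D P x : closed D -> (forall z, z \in D -> sm V z) ->
  {subset P <= D} -> uniq P -> (size P).+1 = mm -> sm V x -> ~ sm D x ->
  exists y, [/\ sm V y, y \notin D, {in D, forall z, R y z = (z \in P)},
    closed (y :: D) & (δ (y :: D) = δ D + 1)%R].
Proof.
move=> cD sDV sPD uP szP sVx nDx.
have xD : x \notin D by apply/negP => /sm_ext.
have [|K tK sK] := @sm_cover V (x :: D).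
  by move=> z; rewrite inE => /predU1P[->|/sDV].
have xK : x \in K by apply: sK; rewrite mem_head.
have sDK : {subset D <= K} by move=> z zD; apply: sK; rewrite inE zD orbT.
have cK := tight_closed tK.
have sNK : {subset x :: P <= K}.
  by move=> z; rewrite inE => /predU1P[-> //|/sPD/sDK].
have uN : uniq (x :: P) by rewrite /= uP andbT; apply: contra xD; apply: sPD.
have [|y [yK yR cyK]] := realize_vertex cK sNK uN; first by rewrite /= szP.
have yD : y \notin D by apply: contra yK; apply: sDK.
have yRD : {in D, forall z, R y z = (z \in P)}.
  move=> z zD; rewrite yR ?sDK // inE; case: eqP => // ezx.
  by rewrite -ezx zD in xD.
(* Exactly [mm] neighbours in [K] keep [y] in [sm V]; only [mm - 1] of them lie in [D]. *)
have dyK : δ (y :: K) = δ K.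
  have := @count_undup_ge K (x :: P) y uN; rewrite /= szP.
  rewrite delta_consE //; set c := count _ _ => cle.
  have : mm <= c by apply: cle => z zN; rewrite yR ?zN ?sNK.
  have : c <= mm.
    rewrite -[X in _ <= X]szP -[_.+1]/(size (x :: P)); apply: count_undup_le => z zK.
    by rewrite yR.
  lia.
have dyD : (δ (y :: D) = δ D + 1)%R.
  have : size P <= count (R y) (undup D).
    by apply: count_undup_ge => // z zP; rewrite yRD ?sPD.
  have : count (R y) (undup D) <= size P.
    by apply: count_undup_le => z zD; rewrite yRD.
  by rewrite delta_consE //; lia.
have tyK : tight V (y :: K).
  apply: (tight_le tK); last by rewrite dyK.
  by move=> z /(proj1 tK) zK; rewrite inE zK orbT.
exists y; split=> //; first by exists (y :: K); rewrite ?mem_head.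
apply: (closed_trans cyK).
  by move=> z; rewrite !inE => /predU1P[->|/sDK ->]; rewrite ?eqxx ?orbT.
move=> B sB sBK; pose B0 := interseq B K.
have eB : B =i y :: B0.
  move=> z; rewrite inE mem_interseq; case: eqP => [->|/eqP nzy] /=.
    by rewrite sB // mem_head.
  case zB: (z \in B) => //=; have := sBK z zB.
  by rewrite inE (negPf nzy).
have yB0 : y \notin B0 by rewrite mem_interseq (negPf yK) andbF.
have sDB : {subset D <= B0}.
  by move=> z zD; rewrite mem_interseq sDK // andbT sB // inE zD orbT.
have dB0 : (δ D <= δ B0)%R by move/closedP: cD; apply.
rewrite (eq_delta R mm eB) dyD delta_consE //.
(* Without [x], adding [y] gains at least one. With [x], it may gain nothing, but then [B0] already
   exceeds [D], as [x] is outside [sm D]. *)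
case xB: (x \in B0); last first.
  have : count (R y) (undup B0) <= size P.
    apply: count_undup_le => z zB; have := zB; rewrite mem_interseq => /andP[_ zK].
    by rewrite yR // inE; case: eqP => // ezx; rewrite -ezx zB in xB.
  lia.
have : count (R y) (undup B0) <= size (x :: P).
  apply: count_undup_le => z; rewrite mem_interseq => /andP[_ zK].
  by rewrite yR.
rewrite /= szP; suff : (δ D < δ B0)%R by lia.
rewrite ltNge; apply/negP => leB; apply: nDx; exists B0 => //; split=> // B' sB'.
by apply: le_trans leB _; move/closedP: cD; apply.
Qed.

Lemma tight_mono A V D K : (forall x, x \in A -> sm V x) -> tight A D -> tight V K ->
  (δ D <= δ K)%R.
Proof.
move=> sAV [_ mD] tK; have [K' tK' sK'] := sm_cover sAV.
by rewrite (tight_delta tK tK'); apply: mD.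
Qed.

Lemma sm_full A V D K x : (forall z, z \in A -> sm V z) -> tight A D -> tight V K ->
  δ K = δ D -> sm V x -> sm A x.
Proof.
move=> sAV tD tK eKD; apply: sm_closure => z zV.
have [K' [tK' sKK' sAK']] := sm_cover2 tK sAV.
exists K'; last by apply: (proj1 tK').
by apply: (tight_le tD) => //; rewrite (tight_delta tK' tK) eKD.
Qed.

(** Induction on the codimension of [A] in [V]; at zero, [A] and its image both span [sm V].
    Arbitrary points of [V] over [A] and its image can have different types, but two vertices with
    neighbourhoods [P] and [map g P] correspond and lower the codimension by one. *)
Lemma sm_extend_stable V : 0 < mm -> forall n A g K D, aut g ->
  (forall x, x \in A -> sm V x) -> (forall x, x \in A -> sm V (g x)) ->
  tight V K -> tight A D -> (δ K = δ D + n%:Z)%R ->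
  exists g', [/\ aut g', forall x, sm A x -> g' x = g x &
    forall x, sm V (g' x) <-> sm V x].
Proof.
move=> mm_gt0; have [C [cC dC szC]] := closed_clique.
have tC : tight [::] C by split=> // B _; rewrite dC; apply: delta_ge0.
elim=> [|n IH] A g K D ag sA sgA tK tD dKD.
  rewrite GRing.addr0 in dKD; exists g; split=> // x.
  have sgA' z : z \in map g A -> sm V z by case/mapP=> t tA ->; apply: sgA.
  have tgD := tight_map ag tD.
  split=> sx.
    apply: (sm_closure sA); apply/(sm_map A x ag).
    by apply: (sm_full sgA' tgD tK) sx; rewrite aut_delta.
  apply: (sm_closure sgA'); apply/sm_map => //.
  exact: (sm_full sA tD tK) sx.
(* The clique supplies the [mm - 1] neighbours even when [A] is empty. *)
have sCA z : z \in C -> sm A z by move=> zC; apply: (@sm_closure [::]) => //; exists C.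
have [D' [tD' sDD' sCD']] := sm_cover2 tD sCA.
have dD' : δ D' = δ D := tight_delta tD' tD.
have cD' := tight_closed tD'.
pose P := take mm.-1 (undup C).
have uP : uniq P by rewrite take_uniq ?undup_uniq.
have szP : (size P).+1 = mm by rewrite size_take; case: ifP; lia.
have sPD : {subset P <= D'} by move=> z /mem_take; rewrite mem_undup; apply: sCD'.
have new B E : tight B E -> δ E = δ D -> exists x, sm V x /\ ~ sm E x.
  move=> tE dE; apply: contrapT => nx.
  have sVE z : z \in V -> sm B z.
    move=> zV; have : sm E z.
      by apply: contrapT => nz; apply: nx; exists z; split=> //; apply: sm_ext.
    by apply: sm_closure => t tE'; exists E.
  by have := tight_mono sVE tK tE; lia.
have sD'V z : z \in D' -> sm V z.
  by move=> zD; apply: (sm_closure sA); exists D'.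
have [x [sVx nDx]] := new _ _ tD' dD'.
have [y [sVy yD yR cy dy]] := vertex_of_dim1 cD' sD'V sPD uP szP sVx nDx.
have [|x' [sVx' nDx']] := new _ _ (tight_map ag tD'); first by rewrite aut_delta.
have sgD'V z : z \in map g D' -> sm V z.
  move=> zD; apply: (@sm_closure (map g A)); last by exists (map g D') => //; apply: tight_map.
  by move=> _ /mapP[t tA ->]; apply: sgA.
have sgP : {subset map g P <= map g D'}.
  by move=> _ /mapP[z zP ->]; apply/map_f/sPD.
have ugP : uniq (map g P) by rewrite map_inj_uniq //; apply: (aut_inj ag).
have [|y' [sVy' yD' yR' cy' _]] :=
  vertex_of_dim1 (closed_map ag cD') sgD'V sgP ugP _ sVx' nDx'.
  by rewrite size_map.
have nAy : ~ sm A y.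
  move=> sy; have [D3 [tD3 s3 s4]] := @sm_cover2 A D' [:: y] tD' (fun z zy =>
    eq_rect_r (sm A) sy (elimT eqP (etrans (esym (mem_seq1 z y)) zy))).
  have /closedP/(_ D3) := cy; rewrite (tight_delta tD3 tD') dy => H.
  suff : (δ D' + 1 <= δ D')%R by lia.
  by apply: H => z; rewrite inE => /predU1P[->|/s3 //]; apply: s4; rewrite mem_head.
have [irrR symR] := HR; case: HM => _ [_ [hom _]].
pose h z := if z == y then y' else g z.
have hy : h y = y' by rewrite /h eqxx.
have hD z : z \in D' -> h z = g z.
  by move=> zD; rewrite /h; case: eqP => // ezy; rewrite -ezy zD in yD.
have ynD z : z \in D' -> y' <> g z.
  by move=> zD e; move: yD'; rewrite e map_f.
have hR z : z \in D' -> R y' (g z) = R y z.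
  by move=> zD; rewrite yR // (yR' _ (map_f g zD)) mem_map //; apply: (aut_inj ag).
have [||||f [af fE]] := hom (y :: D') (y' :: map g D') h cy cy'.
- move=> z t; rewrite !inE => /predU1P[->|zD] /predU1P[->|tD1]; rewrite ?hy ?hD //.
  + by move/(ynD _ tD1).
  + by move/esym/(ynD _ zD).
  + exact: (aut_inj ag).
- move=> z; rewrite !inE => /predU1P[->|zD]; first by rewrite hy eqxx.
  by rewrite hD // map_f ?orbT.
- move=> z; rewrite inE => /predU1P[->|/mapP[t tD1 ->]].
    by exists y; rewrite ?mem_head.
  by exists t; rewrite ?inE ?tD1 ?orbT ?hD.
- move=> z t; rewrite !inE => /predU1P[->|zD] /predU1P[->|tD1].
  + by rewrite !irrR.
  + by rewrite hy hD // hR.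
  + by rewrite hy hD // symR hR // symR.
  + by rewrite !hD //; case: ag.
(* [f] agrees with [g] only on the finite set [D']; this restores [g] on all of [sm A]. *)
have [||c [ac cA cE]] := @tight_extension A (y :: D') g f ag af cy.
- by move=> z /(proj1 tD') zD; rewrite inE zD orbT.
- move=> z zD sz; rewrite fE //; move: zD; rewrite inE => /predU1P[ezy|zD].
    by rewrite ezy in sz.
  exact: hD.
have [|||||g' [ag' g'A g'V]] := IH (y :: A) c K (y :: D') ac.
- by move=> z; rewrite inE => /predU1P[->|/sA].
- move=> z; rewrite inE => /predU1P[->|zA].
    by rewrite cE ?mem_head // fE ?mem_head // hy.
  by rewrite cA; [apply: sgA|apply: sm_ext].
- exact: tK.
- split=> [z|B sB].
    by rewrite !inE => /predU1P[->|/(proj1 tD') ->]; rewrite ?eqxx ?orbT.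
  have sAB : {subset A <= B} by move=> z zA; apply: sB; rewrite inE zA orbT.
  have := (proj2 tD') B sAB; rewrite dy => leB.
  suff : δ B <> δ D' by lia.
  move=> eB; apply: nAy; exists B; last by apply: sB; rewrite mem_head.
  by apply: (tight_le tD') => //; rewrite eB.
- by rewrite dy dD' dKD; lia.
exists g'; split=> // z sz; rewrite g'A ?cA //.
by apply: sm_closure sz => t tA; apply: sm_ext; rewrite inE tA orbT.
Qed.

Lemma sm_eppa A V g : 0 < mm -> aut g -> (forall x, x \in A -> sm V x) ->
  (forall x, x \in A -> sm V (g x)) ->
  exists g', [/\ aut g', forall x, sm A x -> g' x = g x &
    forall x, sm V (g' x) <-> sm V x].
Proof.
move=> mm_gt0 ag sA sgA; have [K tK] := tight_exists V.
have [D tD] := tight_exists A; have leDK := tight_mono sA tD tK.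
apply: (@sm_extend_stable V mm_gt0 `|δ K - δ D|%N A g K D) => //; lia.
Qed.

(** Free position of the infinite sets [sm W] and [sm (map q V')] over [sm V] is one equation
    between predimensions of finite tight sets, so a finite free amalgam arranges it. *)
Lemma sm_amalgam V V' W : (forall x, x \in V -> sm V' x) ->
  (forall x, x \in V -> sm W x) ->
  exists q, [/\ aut q, forall x, sm V x -> q x = x & forall a b, aut a -> aut b ->
    (forall x, sm W (a x) <-> sm W x) ->
    (forall x, sm (map q V') (b x) <-> sm (map q V') x) ->
    (forall x, sm V x -> a x = b x) -> (forall x, sm V (a x) <-> sm V x) ->
    exists c, [/\ aut c, forall x, sm W x -> c x = a x &
      forall x, sm (map q V') x -> c x = b x]].
Proof.
move=> sVV' sVW; have [K0 tK0] := tight_exists V.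
have [F1 tF1 sF1] := @sm_cover V' K0 (fun x xK => sm_closure sVV' (tight_sm tK0 xK)).
have [D1 tD1 sD1] := @sm_cover W K0 (fun x xK => sm_closure sVW (tight_sm tK0 xK)).
(* [K] absorbs all of [sm V] visible in [F1] and [D1]. Thus [F] meets [sm V] only in [K], and [q1]
   can be changed off [F] to fix the whole of [sm V]. *)
have [|K [tK sK0 sK1]] := @sm_cover2 V K0 (smpart V F1 ++ smpart V D1) tK0.
  by move=> x; rewrite mem_cat => /orP[] /mem_smpart[].
have sVK := proj1 tK.
have sVF1 : {subset V <= F1} by move=> x /(proj1 tK0)/sF1.
have sVD1 : {subset V <= D1} by move=> x /(proj1 tK0)/sD1.
have [cF dF _] := tight_cat_closed (tight_closed tF1) sVF1 tK.
have [cD dD _] := tight_cat_closed (tight_closed tD1) sVD1 tK.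
set F := F1 ++ K in cF dF; set D := D1 ++ K in cD dD.
have tF : tight V' F.
  apply: (tight_le tF1); last by rewrite dF.
  by move=> x /(proj1 tF1); rewrite mem_cat => ->.
have tD : tight W D.
  apply: (tight_le tD1); last by rewrite dD.
  by move=> x /(proj1 tD1); rewrite mem_cat => ->.
have sKF : {subset K <= F} by move=> x xK; rewrite mem_cat xK orbT.
have sKD : {subset K <= D} by move=> x xK; rewrite mem_cat xK orbT.
have FK x : x \in F -> sm V x -> x \in K.
  rewrite mem_cat => /orP[xF sx|//]; apply: sK1; rewrite mem_cat; apply/orP; left.
  by apply/mem_smpart.
clearbody F D.
have [q1 [aq1 q1K q1D cE0 dE0]] := realize_amalgam cD cF (tight_closed tK) sKD sKF.
have [||q [aq qV qF]] := @tight_extension V F id q1 (aut_id R) aq1 cF.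
- by move=> x /sVK/sKF.
- by move=> x xF sx; apply/q1K/FK.
have eF : map q1 F = map q F by apply/eq_in_map => x xF; rewrite qF.
rewrite eF in cE0 dE0; set V2 := map q V'; have tF' := tight_map aq tF.
rewrite -/V2 in tF'; set F' := map q F in cE0 dE0 tF'.
have sKF' : {subset K <= F'}.
  by move=> x xK; apply/mapP; exists x; rewrite ?sKF // qV //; apply: tight_sm tK xK.
have dF' : δ F' = δ F by apply: aut_delta.
(* Larger tight sets have the same predimensions, so the equation of the finite amalgam persists: no
   cross edges, and an intersection tight over [V]. *)
have big D2 F2 : tight W D2 -> {subset D <= D2} -> tight V2 F2 -> {subset F' <= F2} ->
  [/\ closed (D2 ++ F2), crossedges R D2 F2 = 0 &
     forall x, x \in D2 -> x \in F2 -> sm V x].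
  move=> tD2 sD2 tF2 sF2.
  have [|c1 d1 _] := @tight_cat_closed W _ D2 cE0 _ tD2.
    by move=> x /(proj1 tD) xD; rewrite mem_cat xD.
  have [|c2 d2 _] := @tight_cat_closed V2 _ F2 c1 _ tF2.
    by move=> x /(proj1 tF') xF; rewrite !mem_cat xF !orbT.
  have e2 : (D ++ F') ++ D2 ++ F2 =i D2 ++ F2.
    move=> x; rewrite !mem_cat; apply/idP/idP; last by move=> ->; rewrite orbT.
    by case/orP=> [/orP[/sD2 ->|/sF2 ->]|//]; rewrite ?orbT.
  rewrite -catA in c2 d2; have dU : δ (D2 ++ F2) = δ (D ++ F').
    by rewrite -(eq_delta R mm e2) d2 d1.
  have tI : tight V (interseq D2 F2).
    apply: (tight_le tK).
      by move=> x /sVK xK; rewrite mem_interseq sD2 ?sF2 ?sKF' ?sKD.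
    have := submodular D2 F2.
    by rewrite dU (tight_delta tD2 tD) (tight_delta tF2 tF') dF'; lia.
  split; first exact: eq_closed e2 c2.
    apply: crossedges_eq0_delta; rewrite dU (tight_delta tI tK).
    by rewrite (tight_delta tD2 tD) (tight_delta tF2 tF') dF' dE0.
  by move=> x xD xF; exists (interseq D2 F2); rewrite ?mem_interseq ?xD.
have XZ x : sm W x -> sm V2 x -> sm V x.
  move=> sWx sVx; have one A : sm A x -> forall z, z \in [:: x] -> sm A z.
    by move=> sA z; rewrite inE => /eqP ->.
  have [D2 [tD2 s1 s2]] := sm_cover2 tD (one _ sWx).
  have [F2 [tF2 s3 s4]] := sm_cover2 tF' (one _ sVx).
  by have [_ _] := big _ _ tD2 s1 tF2 s3; apply; [apply: s2|apply: s4]; rewrite mem_head.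
exists q; split=> // a b aa ab aW bV eab aV.
have dis y z : sm W y -> sm V2 z -> a y = b z -> y = z.
  move=> sy sz e; apply: (aut_inj ab); rewrite -e -eab //; apply/aV; apply: XZ.
    by apply/aW.
  by rewrite e; apply/bV.
(* Including the preimage of [D] makes [map a D2] contain [D] too, so [big] applies before and after
   the maps. *)
have [|D2 [tD2 s1 s2]] := @sm_cover2 W D (map (inverse a) D) tD.
  by move=> _ /mapP[x xD ->]; apply/aW; rewrite (autVK aa); apply: tight_sm xD.
have [|F2 [tF2 s3 s4]] := @sm_cover2 V2 F' (map (inverse b) F') tF'.
  by move=> _ /mapP[x xD ->]; apply/bV; rewrite (autVK ab); apply: tight_sm xD.
have s1' : {subset D <= map a D2}.
  move=> x xD; apply/mapP; exists (inverse a x); last by rewrite (autVK aa).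
  by apply/s2/map_f.
have s3' : {subset F' <= map b F2}.
  move=> x xD; apply/mapP; exists (inverse b x); last by rewrite (autVK ab).
  by apply/s4/map_f.
have taD : tight W (map a D2).
  apply: (tight_le tD2); last by rewrite aut_delta.
  by move=> x /(proj1 tD)/s1'.
have tbF : tight V2 (map b F2).
  apply: (tight_le tF2); last by rewrite aut_delta.
  by move=> x /(proj1 tF')/s3'.
have [c1 x1 i1] := big _ _ tD2 s1 tF2 s3.
have [c2 x2 _] := big _ _ taD s1' tbF s3'.
have [||h [ah hD hF]] := glue_autos aa ab _ _ c1 c2 x1 x2.
- by move=> x xD xF; apply/eab/i1.
- move=> x y xD yF e; rewrite (dis x y) //.
    exact: tight_sm xD.
  exact: tight_sm yF.
have [||c [ac cA cB _]] := @joint_extension W V2 a b (D2 ++ F2) h aa ab _ dis.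
- by move=> x sW sV2; apply/eab/XZ.
- split=> //=.
  + move=> x; rewrite !mem_cat => /orP[/(proj1 tD2) -> //|/(proj1 tF2) ->].
    by rewrite orbT.
  + move=> x; rewrite mem_cat => /orP[/hD //|xF sx]; rewrite hF // eab //.
    by apply: XZ => //; apply: tight_sm xF.
  + move=> x; rewrite mem_cat => /orP[xD sx|/hF //]; rewrite hD // eab //.
    by apply: XZ => //; apply: tight_sm xD.
by exists c.
Qed.

(** * Comparison with gcl *)

Lemma cl_exists A : exists C, is_cl R mm A C.
Proof.
have [C0 cC0 sC0] := closed_cover A.
suff H n C : closed C -> {subset A <= C} -> size (undup C) <= n ->
    exists C, is_cl R mm A C by apply: (H _ C0).
elim: n C => [|n IH] C cC sC szC.
  exists C; split=> //; split=> // D _ _ x; rewrite -mem_undup.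
  by move: szC; rewrite leqn0 size_eq0 => /eqP ->.
case: (pselect (exists D, [/\ closed D, {subset A <= D} & ~ {subset C <= D}])).
  case=> D [cD sD nD]; apply: (IH (interseq C D)).
  - exact: closed_interseq.
  - by move=> x xA; rewrite mem_interseq sC ?sD.
  - rewrite -ltnS; apply: leq_trans szC; rewrite ltnNge; apply/negP => le.
    apply: nD => x xC.
    have sub : {subset undup (interseq C D) <= undup C}.
      by move=> y; rewrite !mem_undup mem_interseq => /andP[].
    have [_ eI] := uniq_min_size (undup_uniq _) sub le.
    by move: xC; rewrite -mem_undup -eI mem_undup mem_interseq => /andP[].
move=> nD; exists C; split=> //; split=> // D cD sD.
by apply: contrapT => nC; apply: nD; exists D.
Qed.

(** The closures of [A] and [x :: A] and the tight set [D] form a chain of closed sets with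
    increasing predimension, and [D] attains the least one. *)
Lemma sm_gcl A x : sm A x -> gcl R mm (fun y => y \in A) x.
Proof.
move=> [D tD xD]; exists A; split=> //.
have [C1 cl1] := cl_exists (x :: A); have [C2 cl2] := cl_exists A.
exists C1, C2; do 2!split=> //.
case: cl1 => c1 [s1 m1]; case: cl2 => c2 [s2 m2].
have cD := tight_closed tD.
have sAC1 : {subset A <= C1} by move=> y yA; apply: s1; rewrite inE yA orbT.
have sCD : {subset C1 <= D}.
  by apply: m1 => // y; rewrite inE => /predU1P[->|/(proj1 tD)].
have sC21 : {subset C2 <= C1} by apply: m2.
have le1 : (δ C1 <= δ D)%R by move/closedP: c1; apply.
have le2 : (δ C2 <= δ C1)%R by move/closedP: c2; apply.
by have := (proj2 tD) C2 s2; lia.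
Qed.

End GenericStructure.

(** * Countable hulls and generic tuples *)

Section ClosureSystem.
Variables (T : countType) (R : rel T) (sm : seq T -> T -> Prop).
Implicit Types (A B V W : seq T) (g h : T -> T).
Local Notation aut := (is_aut R).
Hypothesis sm_ext : forall A x, x \in A -> sm A x.
Hypothesis sm_closure : forall A B x,
  (forall y, y \in A -> sm B y) -> sm A x -> sm B x.
Hypothesis sm_map : forall g A x, aut g -> sm (map g A) (g x) <-> sm A x.

(* [sm A] stands for gcl(A); [sub A B] says gcl(A) ⊆ gcl(B), and agreement and
   stability refer to the whole of gcl(A). *)
Definition sub A B := forall x, x \in A -> sm B x.
Definition agree g h A := forall x, sm A x -> g x = h x.
Definition stab g A := forall x, sm A (g x) <-> sm A x.

Lemma sub_refl A : sub A A.
Proof. by move=> x; apply: sm_ext. Qed.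

Lemma subset_sub A B : {subset A <= B} -> sub A B.
Proof. by move=> sAB x /sAB; apply: sm_ext. Qed.

Lemma sub_trans A B C : sub A B -> sub B C -> sub A C.
Proof. by move=> sAB sBC x /sAB; apply: sm_closure. Qed.

Lemma sub_cat A B C : sub (A ++ B) C <-> sub A C /\ sub B C.
Proof.
split=> [s|[sA sB] x]; last by rewrite mem_cat => /orP[/sA|/sB].
by split=> x xS; apply: s; rewrite mem_cat xS ?orbT.
Qed.

Lemma agree_sub g h A B : sub A B -> agree g h B -> agree g h A.
Proof. by move=> sAB e x sx; apply/e/(sm_closure sAB). Qed.

Lemma agree_sym g h A : agree g h A -> agree h g A.
Proof. by move=> e x /e. Qed.

Lemma agree_trans f g h A : agree f g A -> agree g h A -> agree f h A.
Proof. by move=> e1 e2 x sx; rewrite e1 ?e2. Qed.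

Lemma sub_map g A B : aut g -> sub A B -> sub (map g A) (map g B).
Proof. by move=> ag s _ /mapP[x xA ->]; apply/sm_map => //; apply: s. Qed.

Lemma sm_mapV g A x : aut g -> sm (map g A) x <-> sm A (inverse g x).
Proof. by move=> ag; rewrite -(sm_map A (inverse g x) ag) (autVK ag). Qed.

Lemma stabP g A : aut g -> (forall x, x \in A -> sm A (g x)) ->
  (forall x, x \in A -> sm A (inverse g x)) -> stab g A.
Proof.
move=> ag s1 s2 x; split=> sx.
  apply: (@sm_closure (map (inverse g) A)).
    by move=> _ /mapP[y yA ->]; apply: s2.
  by rewrite -(autK ag x); apply/sm_map => //; apply: aut_inverse.
apply: (@sm_closure (map g A)); last by apply/sm_map.
by move=> _ /mapP[y yA ->]; apply: s1.
Qed.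

Lemma stab_inverse g A : aut g -> stab g A -> stab (inverse g) A.
Proof. by move=> ag s x; rewrite -s (autVK ag). Qed.

Lemma stab_agree g h A B : aut g -> aut h -> sub A B -> agree g h B ->
  stab g A -> stab h A.
Proof.
move=> ag ah sAB e s; have e' := agree_sub sAB e; apply: stabP => // x xA.
  by rewrite -e' ?s; [apply: sm_ext|apply: sm_ext].
have sx : sm A (inverse g x) by rewrite -s (autVK ag); apply: sm_ext.
by rewrite (inverse_eq (x := inverse g x) ah) // -e' // (autVK ag).
Qed.

Lemma stab_agree_id g A : agree g id A -> aut g -> stab g A.
Proof.
by move=> e ag; apply: (@stab_agree id) => //;
  [apply: aut_id|apply: sub_refl|apply: agree_sym].
Qed.

(** * A countable subgroup and its closure *)

Section CountableHull.
Variables (K : countType) (e : K -> T -> T).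
Definition hull g := exists k, g = e k.
Local Notation Q := hull.
Hypothesis Q_aut : forall g, Q g -> aut g.
Hypothesis Q_id : Q id.
Hypothesis Q_comp : forall g h, Q g -> Q h -> Q (g \o h).
Hypothesis Q_inverse : forall g, Q g -> Q (inverse g).
Hypothesis Q_eppa : forall g A V, Q g -> sub A V -> sub (map g A) V ->
  exists g', [/\ Q g', agree g' g A & stab g' V].
Hypothesis Q_amalgam : forall V V' W, sub V V' -> sub V W ->
  exists q, [/\ Q q, agree q id V & forall a b, Q a -> Q b ->
    stab a W -> stab b (map q V') -> agree a b V -> stab a V ->
    exists c, [/\ Q c, agree c a W & agree c b (map q V')]].

(* The closure of the hull for the topology whose basic open subgroups are the
   pointwise stabilisers of the sets [sm A]. *)
Definition apx g := aut g /\ forall A, exists2 q, Q q & agree q g A.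

Lemma apx_aut g : apx g -> aut g. Proof. by case. Qed.

Lemma Q_apx q : Q q -> apx q.
Proof. by move=> Qq; split; [apply: Q_aut|move=> A; exists q]. Qed.

Lemma apx_comp g h : apx g -> apx h -> apx (g \o h).
Proof.
move=> [ag xg] [ah xh]; split; first exact: aut_comp.
move=> A; have [q Qq qh] := xh A; have [r Qr rg] := xg (map h A).
exists (r \o q); first exact: Q_comp.
by move=> x sx /=; rewrite qh // rg //; apply/sm_map.
Qed.

Lemma apx_inverse g : apx g -> apx (inverse g).
Proof.
move=> [ag xg]; split; first exact: aut_inverse.
move=> A; have [q Qq qg] := xg (map (inverse g) A).
exists (inverse q); first exact: Q_inverse.
move=> x sx; have aq := Q_aut Qq; apply: (inverse_eq aq); rewrite qg ?(autVK ag) //.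
by apply/sm_map => //; apply: aut_inverse.
Qed.

(** * Generic tuples and their conjugacy *)

Definition snoc (p : nat -> T -> T) n g i := if i == n then g else p i.

Lemma snoc_lt p n g i : i < n -> snoc p n g i = p i.
Proof. by rewrite /snoc => lt; rewrite ltn_eqF. Qed.

Lemma snoc_last p n g : snoc p n g n = g.
Proof. by rewrite /snoc eqxx. Qed.

Lemma snoc_all (P : nat -> (T -> T) -> Prop) p n g :
  (forall i, i < n.+1 -> P i (snoc p n g i)) <->
  (forall i, i < n -> P i (p i)) /\ P n g.
Proof.
split=> [H|[H1 H2] i].
  split=> [i lt|]; last by have := H n (ltnSn n); rewrite snoc_last.
  by have := H i (ltnW lt); rewrite snoc_lt.
rewrite ltnS leq_eqVlt => /predU1P[->|lt]; first by rewrite snoc_last.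
by rewrite snoc_lt //; apply: H1.
Qed.

Definition cofinal n (p : nat -> T -> T) A :=
  exists2 V, sub A V & forall i, i < n -> stab (p i) V.

(** The extension property of a Fraisse limit for small sets with [n] automorphisms: [k] embeds the
    system [q] on [sm V'] into [p] over [sm V]. *)
Definition universal n (p : nat -> T -> T) V V' (q : nat -> T -> T) :=
  sub V V' -> (forall i, i < n -> stab (p i) V) ->
  (forall i, i < n -> [/\ Q (q i), stab (q i) V' & agree (q i) (p i) V]) ->
  exists k, [/\ Q k, agree k id V &
    forall i, i < n -> forall v, sm V' v -> p i (k v) = k (q i v)].

(* [universal] quantifies over the countable hull only, so genericity is a
   countable intersection of dense open conditions. *)
Definition generic n p := [/\ forall i, i < n -> apx (p i),
  forall A, cofinal n p A & forall V V' q, universal n p V V' q].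

Lemma generic0 p : generic 0 p.
Proof.
split=> // [A|V V' q _ _ _]; first by exists A => //; apply: sub_refl.
by exists id.
Qed.

(** A pair [(g, A)] stands for the restriction of [g] to [sm A]. *)
Definition germ_le (s t : (T -> T) * seq T) :=
  sub s.2 t.2 /\ agree t.1 s.1 s.2.

Lemma germ_le_refl s : germ_le s s.
Proof. by split=> //; apply: sub_refl. Qed.

Lemma germ_le_trans s t u : germ_le s t -> germ_le t u -> germ_le s u.
Proof.
move=> [s1 e1] [s2 e2]; split; first exact: sub_trans s1 s2.
exact: agree_trans (agree_sub s1 e2) e1.
Qed.

Lemma germ_limit (u : nat -> (T -> T) * seq T) :
  (forall n, Q (u n).1) -> (forall m n, m <= n -> germ_le (u m) (u n)) ->
  (forall x, exists n, sm (u n).2 x) ->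
  (forall y, exists n, sm (map (u n).1 (u n).2) y) ->
  exists c, apx c /\ forall n, agree c (u n).1 (u n).2.
Proof.
move=> uQ ule ux uy.
have um m n' : m <= n' -> forall x, sm (u m).2 x -> sm (u n').2 x.
  by move=> le x; apply: sm_closure; case: (ule m n' le).
have [||||c [ac cE]] := @aut_limit _ R (fun n x => sm (u n).2 x) (fun n => (u n).1).
- by move=> m; apply: Q_aut.
- move=> m x xm; have [s1 e1] := ule m m.+1 (leqnSn m); rewrite e1 //.
  by split=> //; apply: um xm.
- by move=> x; case: (ux x) => m; exists m.
- move=> y; case: (uy y) => m sy; have am := Q_aut (uQ m).
  by exists m, (inverse (u m).1 y); split; [apply/(sm_mapV _ _ am)|rewrite (autVK am)].
exists c; split; last by move=> m x; apply: cE.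
split=> // A; suff [m sA] : exists m, sub A (u m).2.
  by exists (u m).1 => // x sx; rewrite (cE m) //; apply: sm_closure sx.
elim: A => [|x A [m sA]]; first by exists 0.
case: (ux x) => m' sx; exists (maxn m m') => y.
rewrite inE => /predU1P[->|/sA sy].
  exact: um (leq_maxr m m') _ sx.
exact: um (leq_maxl m m') _ sy.
Qed.

Definition conj_state n (p r : nat -> T -> T) (s : (T -> T) * seq T) :=
  [/\ Q s.1, forall i, i < n -> stab (p i) s.2 &
      forall i, i < n -> forall v, sm s.2 v -> r i (s.1 v) = s.1 (p i v)].

Lemma conj_state_stab n p r k V i : generic n p -> generic n r ->
  conj_state n p r (k, V) -> i < n -> stab (r i) (map k V).
Proof.
move=> [xp _ _] [xr _ _] [/= Qk sp rk] lti; have ak := Q_aut Qk.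
have [ap ar] := (apx_aut (xp i lti), apx_aut (xr i lti)).
apply: stabP => // _ /mapP[x xV ->].
  rewrite rk //; last exact: sm_ext.
  by apply/sm_map => //; apply/sp => //; apply: sm_ext.
have sx : sm V (inverse (p i) x) by apply/(sp i lti); rewrite (autVK ap); apply: sm_ext.
rewrite (inverse_eq (x := k (inverse (p i) x)) ar); first exact/sm_map.
by rewrite rk // (autVK ap).
Qed.

(** Cofinality of [p] gives a stable [V'] with [x] in it. Hull approximations of [p] on [sm V'],
    transported by [k], extend the system [r] on [sm (map k V)], and universality of [r] realises
    them. *)
Lemma conj_forth n p r s x : generic n p -> generic n r -> conj_state n p r s ->
  exists t, [/\ conj_state n p r t, germ_le s t & sm t.2 x].
Proof.
case: s => k V gp gr st; have [/= Qk sp rk] := st; have ak := Q_aut Qk.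
have [xp cofp _] := gp; have [xr _ univr] := gr.
have [V' sV' sp'] := cofp (x :: V).
have sVV' : sub V V' by move=> y yV; apply: sV'; rewrite inE yV orbT.
have ex i : exists q, i < n -> Q q /\ agree q (p i) V'.
  case lti: (i < n); last by exists id.
  by have [_ /(_ V')[q Qq qp]] := xp i lti; exists q.
pose q i := projT1 (cid (ex i)).
have qP i : i < n -> Q (q i) /\ agree (q i) (p i) V' by rewrite /q; case: cid.
have [|||k2 [Qk2 k2id k2r]] :=
  univr (map k V) (map k V') (fun i => k \o q i \o inverse k).
- exact: sub_map.
- by move=> i lti; exact: conj_state_stab gp gr st lti.
- move=> i lti; have [Qq qp] := qP i lti; have aq := Q_aut Qq.
  have ap := apx_aut (xp i lti).
  split; first by apply: Q_comp; [apply: Q_comp|apply: Q_inverse].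
    move=> y; rewrite !sm_mapV //= (autK ak).
    by rewrite (stab_agree ap aq (@sub_refl V') (agree_sym qp) (sp' i lti)).
  move=> y /(sm_mapV _ _ ak) sy /=; rewrite qp; last exact: sm_closure sy.
  by rewrite -rk // (autVK ak).
exists (k2 \o k, V'); split=> /=; last by apply: sV'; rewrite mem_head.
  split=> //=; first exact: Q_comp.
  move=> i lti v sv; have [Qq qp] := qP i lti.
  by rewrite k2r //=; [rewrite (autK ak) qp|apply/sm_map].
by split=> //= v sv /=; rewrite k2id //; apply/sm_map.
Qed.

Lemma conj_inverse n p r k V : generic n p -> generic n r ->
  conj_state n p r (k, V) -> conj_state n r p (inverse k, map k V).
Proof.
move=> gp gr st; have [/= Qk sp rk] := st; have ak := Q_aut Qk; split=> /=.
- exact: Q_inverse.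
- by move=> i lti; exact: conj_state_stab gp gr st lti.
- move=> i lti v /(sm_mapV _ _ ak) sv; apply/esym/(inverse_eq ak).
  by rewrite -rk // (autVK ak).
Qed.

Lemma generic_conj n p r V : generic n p -> generic n r ->
  (forall i, i < n -> stab (p i) V) -> (forall i, i < n -> agree (p i) (r i) V) ->
  exists k, [/\ apx k, agree k id V & forall i, i < n -> forall x, r i (k x) = k (p i x)].
Proof.
move=> gp gr sp epr.
have st0 : conj_state n p r (id, V).
  by split=> //= i lti v sv; rewrite epr.
pose task (i : T + T) (s : (T -> T) * seq T) :=
  match i with inl x => sm s.2 x | inr y => sm (map s.1 s.2) y end.
have [|u [u0 uS ule ut]] := generic_chain (task := task) germ_le_refl germ_le_trans _ st0.
  move=> [x|y] [k W] ss; first exact: conj_forth.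
  have ak : aut k by case: ss => /Q_aut.
  have [[k' W'] [st [/= le1 le2] sy]] := conj_forth y gr gp (conj_inverse gp gr ss).
  have ak' : aut k' by case: st => /Q_aut.
  have eW : map k' (map k W) = W.
    rewrite -map_comp map_id_in // => x xW /=; rewrite le2 ?(autK ak) //.
    by apply/sm_map => //; apply: sm_ext.
  exists (inverse k', map k' W'); split.
  - exact: conj_inverse gr gp st.
  - split=> /= [|x sx]; first by rewrite -[X in sub X]eW; apply: sub_map.
    by apply: (inverse_eq ak'); rewrite le2 ?(autK ak) //; apply/sm_map.
  - rewrite /= -map_comp map_id_in // => x _ /=; exact: autK ak' _.
have [|||c [xc cE]] := @germ_limit u _ ule.
- by move=> m; case: (uS m).
- by move=> x; case: (ut (inl x)) => m; exists m.
- by move=> y; case: (ut (inr y)) => m; exists m.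
exists c; split=> //.
- by move=> x sx; rewrite (cE 0) u0.
- move=> i lti x; case: (ut (inl x)) => m sx; have [_ sm' rk] := uS m.
  by rewrite (cE m) // rk // (cE m) //; apply/sm'.
Qed.

(** * Dense open conditions within the pointwise stabiliser of a small set *)

Definition dense_open B (O : (T -> T) -> Prop) := forall q W,
  Q q -> agree q id B -> sub B W -> exists q' W',
  [/\ Q q', sub W W', agree q' q W & forall g, apx g -> agree g q' W' -> O g].

Lemma dense_stable n p q W A : generic n p -> Q q -> exists q' V,
  [/\ Q q', sub W V, sub A V, agree q' q W &
      stab q' V /\ forall i, i < n -> stab (p i) V].
Proof.
move=> [_ cof _] Qq; have [V] := cof (W ++ A ++ map q W).
case/sub_cat=> sW /sub_cat[sA sqW] sp.
by have [q' [Qq' eq' sq']] := Q_eppa Qq sW sqW; exists q', V.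
Qed.

Lemma cofinal_dense n p B A : generic n p ->
  dense_open B (fun g => cofinal n.+1 (snoc p n g) A).
Proof.
move=> gp q W Qq _ _; have [q' [V [Qq' sW sA eq' [sq' sp]]]] := dense_stable W A gp Qq.
exists q', V; split=> // g xg eg; exists V => //.
apply/(snoc_all (fun _ h => stab h V)); split=> //.
by apply: (@stab_agree q' g V V) => //;
  [apply: Q_aut|apply: apx_aut|apply: sub_refl|apply: agree_sym].
Qed.

Lemma stab_cat c A B : aut c -> (forall x, x \in A -> sm A (c x)) ->
  (forall x, x \in A -> sm A (inverse c x)) -> (forall x, x \in B -> sm B (c x)) ->
  (forall x, x \in B -> sm B (inverse c x)) -> stab c (A ++ B).
Proof.
move=> ac A1 A2 B1 B2.
have sA x : sm A x -> sm (A ++ B) x.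
  by apply: sm_closure; apply: subset_sub => y yA; rewrite mem_cat yA.
have sB x : sm B x -> sm (A ++ B) x.
  by apply: sm_closure; apply: subset_sub => y yA; rewrite mem_cat yA orbT.
by apply: stabP => // x; rewrite mem_cat => /orP[] xS; auto.
Qed.

(** The system [q] is moved by [k0] into free position and amalgamated with the current maps on
    [W1]. Universality of the old tuple realises the first [n] maps by [k3]; the last one,
    conjugated by [k3], is the new germ. *)
Lemma universal_dense n p B V V' q : generic n p ->
  dense_open B (fun g => universal n.+1 (snoc p n g) V V' q).
Proof.
move=> gp k W Qk kB sBW; have [xp _ univ] := gp.
have [k1 [W1 [Qk1 sW1 sA1 ek1 [sk1 sp1]]]] := dense_stable W (V ++ V') gp Qk.
have [sVW1 _] := (sub_cat V V' W1).1 sA1.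
have ak1 := Q_aut Qk1.
pose hyp g := [/\ sub V V', forall i, i < n.+1 -> stab (snoc p n g i) V &
  forall i, i < n.+1 -> [/\ Q (q i), stab (q i) V' & agree (q i) (snoc p n g i) V]].
have hypE g h : aut g -> aut h -> agree g h W1 -> hyp g -> hyp h.
  move=> ag ah egh [h1 h2 h3]; split=> // i lti.
    move: (h2 i lti); rewrite /snoc; case: eqP => // _.
    exact: (stab_agree ag ah sVW1 egh).
  have [Qi si ei] := h3 i lti; split=> //; move: ei; rewrite /snoc; case: eqP => // _.
  by move=> /agree_trans; apply; apply: agree_sub egh.
(* The premises depend only on the germ on [W1]; if they fail for [k1], they fail for every [g] that
   agrees with it there. *)
case: (pselect (hyp k1)) => [[sVV' sV eV]|nh]; last first.
  exists k1, W1; split=> // g xg eg h1 h2 h3; case: nh.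
  by apply: (hypE g k1) => //; apply: apx_aut.
have [k0 [Qk0 k0V amal]] := Q_amalgam sVV' sVW1; have ak0 := Q_aut Qk0.
have ex i : exists c, i < n.+1 -> [/\ Q c, agree c (snoc p n k1 i) W1,
    forall v, sm V' v -> c (k0 v) = k0 (q i v) & stab c (W1 ++ map k0 V')].
  case lti: (i < n.+1); last by exists id.
  have [a [Qa ea sa]] : exists a, [/\ Q a, agree a (snoc p n k1 i) W1 & stab a W1].
    move: lti; rewrite ltnS leq_eqVlt => /predU1P[->|lti].
      by exists k1; rewrite snoc_last.
    rewrite snoc_lt //; have [ap /(_ W1)[a Qa ea]] := xp i lti.
    exists a; split=> //; apply: (@stab_agree (p i) a W1 W1) => //.
    - exact: Q_aut.
    - exact: sub_refl.
    - exact: agree_sym.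
    - exact: sp1.
  have aa := Q_aut Qa; have [Qqi sqi eqi] := eV i lti; have aqi := Q_aut Qqi.
  have sV1 : stab (snoc p n k1 i) V by apply: sV.
  have as1 : aut (snoc p n k1 i).
    move: lti; rewrite ltnS leq_eqVlt => /predU1P[->|lti]; first by rewrite snoc_last.
    by rewrite snoc_lt //; apply/apx_aut/xp.
  pose b := k0 \o q i \o inverse k0.
  have Qb : Q b by apply: Q_comp; [apply: Q_comp|apply: Q_inverse].
  have sb : stab b (map k0 V').
    by move=> y; rewrite !sm_mapV //= (autK ak0) sqi.
  have eab : agree a b V.
    move=> x sx; rewrite ea; last exact: sm_closure sx.
    have -> : b x = k0 (q i x).
      by congr (k0 (q i _)); apply: (inverse_eq ak0); rewrite k0V.
    by rewrite eqi // k0V //; apply/sV1.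
  have saV : stab a V := stab_agree as1 aa sVW1 (agree_sym ea) sV1.
  have [c [Qc ca cb]] := amal a b Qa Qb sa sb eab saV; have ac := Q_aut Qc.
  exists c => _; split=> //.
  - exact: agree_trans ca ea.
  - move=> v sv; rewrite cb; last by apply/sm_map.
    by rewrite /b /= (autK ak0).
  - have sc1 : stab c W1.
      exact: (@stab_agree a c W1 W1 aa ac (@sub_refl W1) (agree_sym ca) sa).
    have sc2 : stab c (map k0 V').
      exact: (stab_agree (Q_aut Qb) ac (@sub_refl _) (agree_sym cb) sb).
    have [sc1' sc2'] := (stab_inverse ac sc1, stab_inverse ac sc2).
    by apply: stab_cat => // x xS; [apply/sc1|apply/sc1'|apply/sc2|apply/sc2'];
      apply: sm_ext.
pose c i := projT1 (cid (ex i)).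
have cP i : i < n.+1 -> [/\ Q (c i), agree (c i) (snoc p n k1 i) W1,
    forall v, sm V' v -> c i (k0 v) = k0 (q i v) & stab (c i) (W1 ++ map k0 V')].
  by rewrite /c; case: cid.
have sW12 : sub W1 (W1 ++ map k0 V') by apply: subset_sub => x xW; rewrite mem_cat xW.
have [|k3 [Qk3 k3W k3p]] := univ W1 (W1 ++ map k0 V') c sW12 sp1.
  move=> i lti; have [Qc ec _ sc] := cP i (ltnW lti); split=> //.
  by move: ec; rewrite snoc_lt.
have ak3 := Q_aut Qk3; have [Qc ec ec' sc] := cP n (ltnSn n); rewrite snoc_last in ec.
exists (k3 \o c n \o inverse k3), (W ++ map k3 (W1 ++ map k0 V')); split.
- by apply: Q_comp; [apply: Q_comp|apply: Q_inverse].
- by apply: subset_sub => x xW; rewrite mem_cat xW.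
- move=> x sx; have sx1 : sm W1 x := sm_closure sW1 sx.
  have -> : (k3 \o c n \o inverse k3) x = k3 (c n x).
    by congr (k3 (c n _)); apply: (inverse_eq ak3); rewrite k3W.
  by rewrite ec // (k3W (k1 x)) ?ek1 // -ek1 //; apply/sk1.
- move=> g xg eg _ _ _; exists (k3 \o k0); split; first exact: Q_comp.
    move=> x sx /=; rewrite k0V // k3W //; exact: sm_closure sx.
  have sk0 v : sm V' v -> sm (W1 ++ map k0 V') (k0 v).
    move=> sv; apply: (@sm_closure (map k0 V')); last by apply/sm_map.
    by apply: subset_sub => x xW; rewrite mem_cat xW orbT.
  apply/(snoc_all (fun i h => forall v, sm V' v -> h ((k3 \o k0) v) = (k3 \o k0) (q i v))).
  split=> [i lti v sv|v sv] /=.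
    by have [_ _ ci _] := cP i (ltnW lti); rewrite k3p ?ci //; apply: sk0.
  rewrite eg /=; first by rewrite (autK ak3) ec'.
  apply: (@sm_closure (map k3 (W1 ++ map k0 V'))).
    by apply: subset_sub => x xW; rewrite mem_cat xW orbT.
  by apply/sm_map => //; apply: sk0.
Qed.

(** Only [n.+1] entries of [q] matter and each has a code in [K], so lists of codes reduce the
    conditions to countably many. *)
Lemma generic_snoc n p g (k0 : K) : generic n p -> apx g ->
  (forall A, cofinal n.+1 (snoc p n g) A) ->
  (forall V V' (ks : seq K), universal n.+1 (snoc p n g) V V' (e \o nth k0 ks)) ->
  generic n.+1 (snoc p n g).
Proof.
move=> [xp _ _] xg cof univ; split=> //.
  by apply/(snoc_all (fun _ => apx)).
move=> V V' q sV sp eq.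
have ex i : exists k, i < n.+1 -> q i = e k.
  case lti: (i < n.+1); last by exists k0.
  by have [[k qk] _ _] := eq i lti; exists k.
pose ks := mkseq (fun i => projT1 (cid (ex i))) n.+1.
have ksE i : i < n.+1 -> (e \o nth k0 ks) i = q i.
  by move=> lti; rewrite /= nth_mkseq //; case: cid => k /= ->.
have [|k [Qk kV kp]] := univ V V' ks sV sp.
  by move=> i lti; rewrite ksE //; apply: eq.
by exists k; split=> // i lti v sv; rewrite kp // ksE.
Qed.

Lemma dense_open_meet (I : countType) (O : I -> (T -> T) -> Prop) B g0 :
  (forall i, dense_open B (O i)) -> apx g0 -> agree g0 id B ->
  exists p, [/\ apx p, agree p id B & forall i, O i p /\ O i (p \o g0)].
Proof.
move=> dO xg0 g0B; have ag0 := apx_aut xg0.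
pose Inv (s : (T -> T) * seq T) := [/\ Q s.1, agree s.1 id B & sub B s.2].
pose task (t : (I + I) + (T + T)) (s : (T -> T) * seq T) :=
  match t with
  | inl (inl i) => forall g, apx g -> agree g s.1 s.2 -> O i g
  | inl (inr i) => forall g, apx g -> agree g s.1 s.2 -> O i (g \o g0)
  | inr (inl x) => sm s.2 x
  | inr (inr y) => sm (map s.1 s.2) y
  end.
have I0 : Inv (id, B) by split=> //; apply: sub_refl.
have [|u [u0 uS ule ut]] :=
  generic_chain (task := task) germ_le_refl germ_le_trans _ I0.
  move=> t [q W] [/= Qq qB sBW]; have aq := Q_aut Qq.
  have sWx x : sub W (W ++ [:: x]) by apply: subset_sub => y yW; rewrite mem_cat yW.
  case: t => [[i|i]|[x|y]] /=.
  - have [q' [W' [Qq' sW eq' oq']]] := dO i q W Qq qB sBW.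
    exists (q', W'); split=> //; split=> //=; last exact: sub_trans sBW sW.
    exact: agree_trans (agree_sub sBW eq') qB.
  (* A condition on [g \o g0] is met over the preimage of [W] and divided back. Since [g0] need not
     be in the hull, [q1] and [q2] replace it on the relevant small sets. *)
  - pose W2 := map (inverse g0) W.
    have ag0V := aut_inverse ag0.
    have [_ /(_ W2)[q1 Qq1 q1E]] := xg0.
    have sB2 : sub B W2.
      move=> x xB; rewrite -(sm_map _ _ ag0) /W2 -map_comp.
      rewrite (eq_map (g := id)) ?map_id; last by move=> y /=; rewrite (autVK ag0).
      by rewrite g0B; [apply: sBW|apply: sm_ext].
    have q1B : agree (q \o q1) id B.
      move=> x sx /=; rewrite q1E; last exact: sm_closure sx.
      by rewrite g0B // qB.
    have [q' [W' [Qq' sW eq' oq']]] := dO i _ W2 (Q_comp Qq Qq1) q1B sB2.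
    have [_ /(_ W')[q2 Qq2 q2E]] := xg0; have aq2 := Q_aut Qq2.
    have sWW : sub W (map g0 W').
      move=> x xW; rewrite -(autVK ag0 x); apply/sm_map => //; apply: sW.
      exact: map_f.
    have eqq : agree (q' \o inverse q2) q W.
      move=> x sx /=; have sx2 : sm W2 (inverse g0 x) by apply/sm_map.
      rewrite (inverse_eq (x := inverse g0 x) aq2).
        by rewrite eq' //= q1E // (autVK ag0).
      by rewrite q2E ?(autVK ag0) //; apply: sm_closure sx2.
    exists (q' \o inverse q2, map g0 W'); split=> /=.
    + split=> /=; first by apply: Q_comp => //; apply: Q_inverse.
        exact: agree_trans (agree_sub sBW eqq) qB.
      exact: sub_trans sBW sWW.
    + by split.
    + move=> g xg eg; apply: oq'; first exact: apx_comp.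
      move=> v sv /=; rewrite eg /=; last by apply/sm_map.
      by rewrite (inverse_eq (x := v) aq2) ?q2E.
  - exists (q, W ++ [:: x]); split=> /=.
    + by split=> //=; apply: sub_trans sBW _.
    + by split=> //=; apply: sWx.
    by apply: sm_ext; rewrite mem_cat mem_head orbT.
  - exists (q, W ++ [:: inverse q y]); split=> /=.
    + by split=> //=; apply: sub_trans sBW _.
    + by split=> //=; apply: sWx.
    by apply: sm_ext; rewrite map_cat mem_cat /= (autVK aq) mem_head orbT.
have [|||c [xc cE]] := @germ_limit u _ ule.
- by move=> m; case: (uS m).
- by move=> x; case: (ut (inr (inl x))) => m; exists m.
- by move=> y; case: (ut (inr (inr y))) => m; exists m.
exists c; split=> //.
  by move=> x sx; rewrite (cE 0) u0.
move=> i; split; [case: (ut (inl (inl i)))|case: (ut (inl (inr i)))] => m; exact.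
Qed.

Lemma all_bitseqs n : exists L : seq (seq bool), forall s, size s = n -> s \in L.
Proof.
exists [seq tval t | t <- enum {: n.-tuple bool}] => s sz.
by apply/mapP; exists (Tuple (introT eqP sz)); rewrite ?mem_enum.
Qed.

(* Only u t is modified: it is moved so that (u s)^-1 (u t) enters O. *)
Lemma dense_open_pairs B O (L : seq (seq bool * seq bool)) (u : seq bool -> T -> T) W :
  dense_open B O -> (forall s, Q (u s) /\ agree (u s) id B) -> sub B W ->
  exists u' W', [/\ forall s, Q (u' s) /\ agree (u' s) id B, sub W W',
    forall s, agree (u' s) (u s) W &
    forall s t, (s, t) \in L -> s <> t -> forall g h, apx g -> apx h ->
      agree g (u' s) W' -> agree h (u' t) W' -> O (inverse g \o h)].
Proof.
move=> dO uQ sBW; elim: L => [|[s t] L [u1 [W1 [u1Q sW1 e1 f1]]]].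
  by exists u, W; split=> //; apply: sub_refl.
case: (pselect (s = t)) => [<-|nst].
  exists u1, W1; split=> // s' t'; rewrite inE => /predU1P[[-> ->] //|].
  exact: f1.
have sB1 := sub_trans sBW sW1.
have [[Qs sB] [Qt tB]] := (u1Q s, u1Q t); have [as_ at_] := (Q_aut Qs, Q_aut Qt).
have Qw : Q (inverse (u1 s) \o u1 t) by apply: Q_comp => //; apply: Q_inverse.
have wB : agree (inverse (u1 s) \o u1 t) id B.
  by move=> x sx /=; rewrite tB //; apply: (inverse_eq as_); rewrite sB.
have [w [W2 [Qw2 sW2 ew ow]]] := dO _ _ Qw wB sB1; have aw := Q_aut Qw2.
have s2 : sub W1 (W2 ++ map w W2).
  by apply: sub_trans sW2 _; apply: subset_sub => x xW; rewrite mem_cat xW.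
pose u2 r := if r == t then u1 s \o w else u1 r.
have e2 r : agree (u2 r) (u1 r) W1.
  rewrite /u2; case: eqP => [->|_] // x sx /=.
  by rewrite ew //= (autVK as_).
(* For [x] in [sm W2], [h x] is [u1 s (w x)], so [g] must be controlled at [w x]: hence the summand
   [map w W2]. *)
exists u2, (W2 ++ map w W2); split.
- move=> r; split; last exact: agree_trans (agree_sub sB1 (e2 r)) (proj2 (u1Q r)).
  by rewrite /u2; case: eqP => _; [apply: Q_comp|case: (u1Q r)].
- exact: sub_trans sW1 s2.
- by move=> r; apply: agree_trans (agree_sub sW1 (e2 r)) (e1 r).
- move=> s' t'; rewrite inE => /predU1P[[-> ->]|inL] nst' g h xg xh eg eh; last first.
    apply: (f1 s' t') => //.
      exact: agree_trans (agree_sub s2 eg) (e2 s').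
    exact: agree_trans (agree_sub s2 eh) (e2 t').
  apply: ow; first by apply: apx_comp => //; apply: apx_inverse.
  move=> x sx /=; apply: (inverse_eq (apx_aut xg)); rewrite eg.
    rewrite /u2; have /eqP/negPf -> := nst.
    rewrite eh /u2 ?eqxx //; apply: sm_closure sx.
    by apply: subset_sub => y yW; rewrite mem_cat yW.
  apply: (@sm_closure (map w W2)); last by apply/sm_map.
  by apply: subset_sub => y yW; rewrite mem_cat yW orbT.
Qed.

(** A Cantor scheme in the style of Mycielski. Each condition recurs at arbitrarily high levels,
    since two branches become distinct nodes only past their first difference. *)
Lemma dense_open_perfect (I : countType) (O : I -> (T -> T) -> Prop) B :
  (forall i, dense_open B (O i)) -> exists F : (nat -> bool) -> T -> T,
  (forall s, apx (F s) /\ agree (F s) id B) /\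
  forall s t, s <> t -> forall i, O i (inverse (F s) \o F t).
Proof.
move=> dO; pose S := (nat * (seq bool -> T -> T) * seq T)%type.
pose Inv (s : S) := (forall b, Q (s.1.2 b) /\ agree (s.1.2 b) id B) /\ sub B s.2.
pose le (s t : S) := [/\ s.1.1 <= t.1.1, sub s.2 t.2 &
  forall b, size b = t.1.1 -> agree (t.1.2 b) (s.1.2 (take s.1.1 b)) s.2].
have le_refl s : le s s.
  by split=> // [|b sz]; [apply: sub_refl|rewrite take_oversize ?sz].
have le_tr s t u : le s t -> le t u -> le s u.
  move=> [l1 s1 e1] [l2 s2 e2]; split; [exact: leq_trans l2|exact: sub_trans s2|].
  move=> b sz; apply: agree_trans (agree_sub s1 (e2 b sz)) _.
  rewrite -(take_takel b l1); apply: e1; rewrite size_take sz.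
  by case: ltngtP l2 => // ->.
pose task (t : (I * nat) + (T + T)) (s : S) :=
  match t with
  | inl (i, m) => m <= s.1.1 /\ forall a b, size a = s.1.1 -> size b = s.1.1 ->
      a <> b -> forall g h, apx g -> apx h -> agree g (s.1.2 a) s.2 ->
      agree h (s.1.2 b) s.2 -> O i (inverse g \o h)
  | inr (inl x) => sm s.2 x
  | inr (inr y) => forall b, size b = s.1.1 -> sm (map (s.1.2 b) s.2) y
  end.
have I0 : Inv (0, fun=> id, B) by split=> //; apply: sub_refl.
have [|u [u0 uS ule ut]] := generic_chain (task := task) le_refl le_tr _ I0.
  move=> t [[n v] W] [/= vQ sBW]; have [L LP] := all_bitseqs n.
  have sWx A : sub W (W ++ A) by apply: subset_sub => y yW; rewrite mem_cat yW.
  have take_n b : size b = n -> take n b = b by move=> sz; rewrite take_oversize ?sz.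
  case: t => [[i m]|[x|y]] /=.
  - have [M MP] := all_bitseqs (maxn n m).
    have [|v' [W' [v'Q sW ev fv]]] := @dense_open_pairs B (O i)
      [seq (a, b) | a <- M, b <- M] (fun b => v (take n b)) W (dO i) _ sBW.
      by move=> b; apply: vQ.
    exists (maxn n m, v', W'); split=> /=.
    + by split=> //=; apply: sub_trans sBW sW.
    + by split=> //=; apply: leq_maxl.
    + split; first exact: leq_maxr.
      move=> a b sza szb; apply: fv; apply: allpairs_f; exact: MP.
  - exists (n, v, W ++ [:: x]); split=> /=.
    + by split=> //=; apply: sub_trans sBW _.
    + by split=> //= b sz; rewrite take_n.
    + by apply: sm_ext; rewrite mem_cat mem_head orbT.
  - exists (n, v, W ++ [seq inverse (v b) y | b <- L]); split=> /=.
    + by split=> //=; apply: sub_trans sBW _.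
    + by split=> //= b sz; rewrite take_n.
    + move=> b sz; have [/Q_aut ab _] := vQ b; apply/(sm_mapV _ _ ab); apply: sm_ext.
      rewrite mem_cat; apply/orP; right; apply/mapP; exists b => //; exact: LP.
pose w (sg : nat -> bool) n := ((u n).1.2 (mkseq sg (u n).1.1), (u n).2).
have ex sg : exists c, apx c /\ forall n, agree c (w sg n).1 (w sg n).2.
  apply: germ_limit.
  - by move=> n; case: (uS n) => /(_ (mkseq sg (u n).1.1)) [].
  - move=> m n lemn; have [l s a] := ule m n lemn; split=> //=.
    have := a (mkseq sg (u n).1.1); rewrite size_mkseq => /(_ erefl).
    rewrite (_ : take _ _ = mkseq sg (u m).1.1) //.
    by rewrite /mkseq -map_take take_iota (minn_idPl l).
  - by move=> x; case: (ut (inr (inl x))) => n; exists n.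
  - move=> y; case: (ut (inr (inr y))) => n Hn; exists n; apply: Hn.
    by rewrite size_mkseq.
exists (fun sg => projT1 (cid (ex sg))); split=> [sg|sg tau nst i].
  case: cid => c /= [xc cE]; split=> // x sx; rewrite (cE 0) /w u0 //=.
case: cid => c /= [xc cE]; case: cid => c' /= [xc' cE'].
have [k nk] : exists k, sg k <> tau k.
  apply: contrapT => nk; apply: nst; apply: funext => k.
  by apply: contrapT => nk'; apply: nk; exists k.
(* Level at least [k.+1] makes position [k] visible in both truncations. *)
have [n [len Hn]] := ut (inl (i, k.+1)).
apply: (Hn (mkseq sg (u n).1.1) (mkseq tau (u n).1.1)) => //.
- by rewrite size_mkseq.
- by rewrite size_mkseq.
- by move=> /(congr1 (nth false ^~ k)); rewrite !nth_mkseq.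
Qed.

Lemma conj_compE k f p r : aut k -> aut f -> (forall x, p (k x) = k (r x)) ->
  inverse (k \o f) \o p \o (k \o f) = inverse f \o r \o f.
Proof.
move=> ak af pk; apply: funext => x /=; apply: (inverse_eq (aut_comp ak af)).
by rewrite /= (autVK af) pk.
Qed.

(** * The tree of cosets for a subgroup of small index *)

Section SmallIndex.
Variable H : (T -> T) -> Prop.
Hypothesis HH : is_subgroup R H.
Hypothesis Hidx : index_lt_continuum R H.
Hypothesis Hbig : forall B, exists g, [/\ Q g, agree g id B & ~ H g].

Let H_comp f g : H f -> H g -> H (f \o g).
Proof. by case: HH => _ [_ [Hc _]]; apply: Hc. Qed.

Let H_inverse g : H g -> H (inverse g).
Proof.
case: HH => Ha [_ [_ Hi]] Hg; apply: (Hi g) => // x.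
exact: (autK (Ha g Hg)).
Qed.

(* Non-membership comes from writing an element outside H as a quotient of two
   generic ones, membership from a perfect family with generic quotients, two
   members of which lie in the same coset of H. *)
Lemma generic_split n p f B (b : bool) : generic n p -> apx f ->
  exists r, [/\ apx r, agree r id B, generic n.+1 (snoc p n r) &
    H (inverse f \o r \o f) <-> b = false].
Proof.
move=> gp xf; have [k0 _] := Q_id; have af := apx_aut xf.
pose O (i : seq T + seq T * seq T * seq K) g :=
  match i with
  | inl A => cofinal n.+1 (snoc p n g) A
  | inr (V, V', ks) => universal n.+1 (snoc p n g) V V' (e \o nth k0 ks)
  end.
have dO i : dense_open B (O i).
  by case: i => [A|[[V V'] ks]]; [apply: cofinal_dense|apply: universal_dense].
have genO g : apx g -> (forall i, O i g) -> generic n.+1 (snoc p n g).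
  move=> xg Og; apply: (@generic_snoc n p g k0) => //.
    by move=> A; apply: (Og (inl A)).
  by move=> V V' ks; apply: (Og (inr (V, V', ks))).
have afV := aut_inverse af.
case: b.
  have [g0 [Qg0 g0id nH]] := Hbig (map (inverse f) B).
  (* [g0] fixes [sm] of the preimage of [B], so this conjugate fixes [sm B]. If [q] and [q \o g]
     both conjugated into [H], then so would their quotient, giving [g0] in [H]. *)
  pose g := f \o g0 \o inverse f.
  have xg : apx g.
    by apply: apx_comp (apx_inverse xf); apply: apx_comp (Q_apx Qg0).
  have gB : agree g id B.
    move=> x sx; rewrite /g /= g0id; first exact: (autVK af).
    by apply/sm_map.
  have [q [xq qB qO]] := dense_open_meet dO xg gB.
  case: (pselect (H (inverse f \o q \o f))) => Hq; last first.
    by exists q; split=> //; apply: genO => // i; case: (qO i).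
  exists (q \o g); split.
  - exact: apx_comp.
  - by move=> x sx /=; rewrite gB // qB.
  - by apply: genO => [|i]; [apply: apx_comp|case: (qO i)].
  - split=> // Hqg; case: nH.
    rewrite (_ : g0 = inverse (inverse f \o q \o f) \o (inverse f \o (q \o g) \o f)).
      by apply: H_comp => //; apply: H_inverse.
    apply: funext => x /=; apply/esym.
    apply: (@inverse_eq _ R); first by do 2?apply: aut_comp => //; apply: apx_aut.
    by rewrite /g /= (autK af).
have [F [FB FO]] := dense_open_perfect dO.
(* If no generic [r] conjugates into [H], no quotient of two members of the family does, and their
   conjugates represent continuum many cosets. *)
apply: contrapT => nr; apply: Hidx.
exists (fun s => inverse f \o F s \o f); split.
  by move=> s; do 2?apply: aut_comp => //; apply/apx_aut/(proj1 (FB s)).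
move=> s t nst [h [Hh eh]]; apply: nr.
have [[xs sB] [xt tB]] := (FB s, FB t); have as_ := apx_aut xs.
exists (inverse (F s) \o F t); split.
- by apply: apx_comp => //; apply: apx_inverse.
- by move=> x sx /=; rewrite tB //; apply: (inverse_eq as_); rewrite sB.
- apply: genO; last by move=> i; apply: FO.
  by apply: apx_comp => //; apply: apx_inverse.
- split=> // _; rewrite (_ : _ \o f = h) //; apply: funext => x /=.
  have /(congr1 f) := eh x; rewrite /= !(autVK af) => ->.
  by rewrite (autK as_) (autK af).
Qed.

(* Level n, generic n-tuple p, approximations f_b (b of length n) to the members of
   the tree, and a set A such that the later factors of f_b fix [sm A] and commute
   with p. *)
Let state := (nat * (nat -> T -> T) * (seq bool -> T -> T) * seq T)%type.
Let lev (s : state) := s.1.1.1.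
Let tup (s : state) := s.1.1.2.
Let fn (s : state) := s.1.2.
Let base (s : state) := s.2.

Definition tree_inv (s : state) := [/\ generic (lev s) (tup s),
  forall i, i < lev s -> stab (tup s i) (base s),
  forall b, size b = lev s -> apx (fn s b) &
  forall b i, size b = lev s -> i < lev s ->
    (H (inverse (fn s b) \o tup s i \o fn s b) <-> nth false b i = false)].

(** A left factor commuting with the old entries does not change their conjugates by [fn], so
    decisions about [H] persist. *)
Definition tree_le (s t : state) := [/\ lev s <= lev t,
  forall i, i < lev s -> tup t i = tup s i, sub (base s) (base t) &
  forall b, size b = lev t -> exists k, [/\ aut k, agree k id (base s),
    forall i, i < lev s -> forall x, tup s i (k x) = k (tup s i x) &
    fn t b = k \o fn s (take (lev s) b)]].

Lemma tree_le_refl s : tree_le s s.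
Proof.
split=> //; first exact: sub_refl.
by move=> b sz; exists id; rewrite take_oversize ?sz //; split=> //; apply: aut_id.
Qed.

Lemma tree_le_trans s t u : tree_le s t -> tree_le t u -> tree_le s u.
Proof.
move=> [l1 p1 b1 k1] [l2 p2 b2 k2]; split.
- exact: leq_trans l2.
- by move=> i lti; rewrite p2 ?p1 //; apply: leq_trans l1.
- exact: sub_trans b2.
- move=> b sz; have [k [ak kB kp ek]] := k2 b sz.
  have [|k' [ak' kB' kp' ek']] := k1 (take (lev t) b).
    by rewrite size_take sz; case: ltngtP l2 => // ->.
  exists (k \o k'); split; first exact: aut_comp.
  + by move=> x sx /=; rewrite kB' // kB //; apply: sm_closure sx.
  + move=> i lti x /=; rewrite -kp' //; rewrite -(p1 i lti) kp //.
    exact: leq_trans l1.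
  + by rewrite ek ek' take_takel.
Qed.

(** Splitting gives each node its own new entry [r], whereas the tuple must be shared. Both [r] and
    [r0] are the identity on [sm B], so a conjugator [k] over [B] commuting with [p] carries [r] to
    [r0] and is absorbed into the node. *)
Lemma tree_step s : tree_inv s ->
  exists t, [/\ tree_inv t, tree_le s t & lev t = (lev s).+1].
Proof.
case: s => [[[n p] f] B] [/= gp sp xf Hf]; rewrite /lev /tup /fn /base /= in gp sp xf Hf *.
have [r0 [xr0 r0B gr0 _]] := generic_split B false gp (Q_apx Q_id).
have ex b : exists k, size b = n.+1 -> [/\ apx k, agree k id B,
    forall i, i < n -> forall x, p i (k x) = k (p i x) &
    (H (inverse (k \o f (take n b)) \o r0 \o (k \o f (take n b))) <->
     nth false b n = false)].
  case: (pselect (size b = n.+1)) => [sz|nsz]; last by exists id.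
  have xfb : apx (f (take n b)) by apply: xf; rewrite size_take sz ltnSn.
  have [r [xr rB gr Hr]] := generic_split B (nth false b n) gp xfb.
  have [||k [xk kB kr]] := @generic_conj _ _ _ B gr gr0.
  - apply/(snoc_all (fun _ h => stab h B)); split=> //.
    by apply: stab_agree_id => //; apply: apx_aut.
  - move=> i; rewrite ltnS leq_eqVlt => /predU1P[->|lti].
      by rewrite !snoc_last; apply: agree_trans rB (agree_sym r0B).
    by rewrite !snoc_lt.
  exists k => _; split=> //.
    by move=> i lti x; have := kr i (ltnW lti) x; rewrite !snoc_lt.
  rewrite (@conj_compE k (f (take n b)) r0 r) //; [exact: apx_aut|exact: apx_aut|].
  by move=> x; have := kr n (ltnSn n) x; rewrite !snoc_last.
pose k b := projT1 (cid (ex b)).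
have kP b : size b = n.+1 -> [/\ apx (k b), agree (k b) id B,
    forall i, i < n -> forall x, p i (k b x) = k b (p i x) &
    (H (inverse (k b \o f (take n b)) \o r0 \o (k b \o f (take n b))) <->
     nth false b n = false)] by rewrite /k; case: cid.
have sz_take (b : seq bool) : size b = n.+1 -> size (take n b) = n.
  by move=> sz; rewrite size_take sz ltnSn.
exists (n.+1, snoc p n r0, fun b => k b \o f (take n b), B).
rewrite /tree_inv /tree_le /lev /tup /fn /base /=; split=> //.
- split=> //.
  + apply/(snoc_all (fun _ h => stab h B)); split=> //.
    by apply: stab_agree_id => //; apply: apx_aut.
  + by move=> b sz; have [xk _ _ _] := kP b sz; apply: apx_comp => //; apply/xf/sz_take.
  + move=> b i sz; have [xk _ kp Hk] := kP b sz.
    rewrite ltnS leq_eqVlt => /predU1P[->|lti]; first by rewrite snoc_last.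
    rewrite snoc_lt // (@conj_compE _ _ _ (p i)); [|exact: apx_aut| |exact: kp].
      by rewrite Hf ?nth_take ?sz_take.
    by apply/apx_aut/xf/sz_take.
- split=> //.
  + by move=> i lti; rewrite snoc_lt.
  + exact: sub_refl.
  + move=> b sz; have [xk kB kp _] := kP b sz; exists (k b); split=> //.
    exact: apx_aut.
Qed.

Lemma no_small_index : False.
Proof.
pose task (t : nat + T) (s : state) :=
  match t return Prop with
  | inl m => m <= lev s
  | inr x => sm (base s) x /\ forall b, size b = lev s -> sm (base s) (fn s b x)
  end.
have I0 : tree_inv (0, fun=> id, fun=> id, [::]).
  split=> //; [exact: generic0|by move=> b _; apply: Q_apx].
have [|u [_ uS ule ut]] :=
  generic_chain (task := task) tree_le_refl tree_le_trans _ I0.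
  move=> [m|x] s Is /=.
    suff [t [It st lt]] : exists t, [/\ tree_inv t, tree_le s t & lev t = lev s + m].
      by exists t; split=> //; rewrite lt leq_addl.
    elim: m => [|m [t [It st lt]]].
      by exists s; rewrite addn0; split=> //; apply: tree_le_refl.
    have [t' [It' tt' lt']] := tree_step It; exists t'; split=> //.
      exact: tree_le_trans tt'.
    by rewrite lt' lt addnS.
  case: s Is => [[[n p] f] B] [/= gp sp xf Hf].
  rewrite /lev /tup /fn /base /= in gp sp xf Hf *.
  have [L LP] := all_bitseqs n; have [_ cof _] := gp.
  have [B' /sub_cat[sB sx] sp'] := cof (B ++ x :: [seq f b x | b <- L]).
  exists (n, p, f, B'); rewrite /tree_inv /tree_le /lev /tup /fn /base /=; split=> //.
    split=> // b sz; exists id; rewrite take_oversize ?sz //.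
    by split=> //; apply: aut_id.
  split; first by apply: sx; rewrite mem_head.
  by move=> b sz; apply: sx; rewrite inE; apply/orP; right; apply/map_f/LP.
pose f (sg : nat -> bool) n := fn (u n) (mkseq sg (lev (u n))).
have af sg n : aut (f sg n).
  by have [_ _ xf _] := uS n; apply/apx_aut/xf; rewrite size_mkseq.
have fle sg m n : m <= n -> exists k, [/\ aut k, agree k id (base (u m)),
    forall i, i < lev (u m) -> forall x, tup (u m) i (k x) = k (tup (u m) i x) &
    f sg n = k \o f sg m].
  move=> lemn; have [l _ _ lk] := ule m n lemn.
  have := lk (mkseq sg (lev (u n))); rewrite size_mkseq => /(_ erefl).
  rewrite (_ : take _ _ = mkseq sg (lev (u m))) //.
  by rewrite /mkseq -map_take take_iota (minn_idPl l).
(* Later factors act on the left and fix the base, so a value is final once it lies in the base: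
   domains are defined through values. *)
pose dom sg n x := sm (base (u n)) (f sg n x).
have dmono sg m n x : m <= n -> dom sg m x -> dom sg n x /\ f sg n x = f sg m x.
  move=> lemn dx; have [k [_ kB _ ek]] := fle sg m n lemn.
  rewrite /dom ek /= kB //; split=> //.
  by have [_ _ sB _] := ule m n lemn; apply: sm_closure dx.
have dom_ex sg x : exists n, dom sg n x.
  have [n [_ Hn]] := ut (inr x); exists n; apply: Hn; exact: size_mkseq.
have ex sg : exists c, aut c /\ forall n x, dom sg n x -> c x = f sg n x.
  apply: aut_limit => //.
  - by move=> n x; apply: dmono.
  - move=> y; have [n [sy _]] := ut (inr y); exists n, (inverse (f sg n) y).
    by rewrite /dom (autVK (af sg n)).
pose F sg := projT1 (cid (ex sg)).
have FP sg : aut (F sg) /\ forall n x, dom sg n x -> F sg x = f sg n x.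
  by rewrite /F; case: cid.
have HF sg n i : i < lev (u n) ->
    (H (inverse (F sg) \o tup (u n) i \o F sg) <-> sg i = false).
  move=> lti; have [aF FE] := FP sg; have [_ _ _ Hf] := uS n.
  have := Hf (mkseq sg (lev (u n))) i; rewrite size_mkseq nth_mkseq // => <- //.
  rewrite -/(f sg n).
  (* At any two points [F sg] equals some [k \o f sg n] with [k] commuting with this entry, so the
     conjugates coincide. *)
  rewrite (_ : inverse (F sg) \o _ \o _ = inverse (f sg n) \o tup (u n) i \o f sg n) //.
  apply: funext => x /=; apply: (inverse_eq aF).
  set y := inverse _ _.
  have [m1 d1] := dom_ex sg x; have [m2 d2] := dom_ex sg y.
  pose m := maxn n (maxn m1 m2).
  have l1 : m1 <= m by rewrite !leq_max leqnn orbT.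
  have l2 : m2 <= m by rewrite !leq_max leqnn !orbT.
  have [[dx _] [dy _]] := (dmono sg m1 m x l1 d1, dmono sg m2 m y l2 d2).
  have [k [_ _ kp ek]] := fle sg n m (leq_maxl _ _).
  by rewrite !(FE m) // ek /= /y (autVK (af sg n)) kp.
apply: Hidx; exists F; split=> [sg|sg tau nst [h [Hh eh]]].
  by case: (FP sg).
apply: nst; apply: funext => i; have [n /= len] := ut (inl i.+1).
have [aF _] := FP sg; have [aF' _] := FP tau.
have ah : aut h by case: HH => Ha _; apply: Ha.
have e1 : inverse (F tau) \o tup (u n) i \o F tau =
    inverse h \o (inverse (F sg) \o tup (u n) i \o F sg) \o h.
  apply: funext => x /=; apply: (inverse_eq aF').
  by rewrite !eh (autVK ah) (autVK aF).
have e2 : inverse (F sg) \o tup (u n) i \o F sg =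
    h \o (inverse (F tau) \o tup (u n) i \o F tau) \o inverse h.
  by rewrite e1; apply: funext => x /=; rewrite !(autVK ah).
have H1 := HF sg n i len; have H2 := HF tau n i len.
have HV := H_inverse Hh.
have : sg i = false <-> tau i = false.
  rewrite -H1 -H2; split=> Hx; [rewrite e1|rewrite e2].
    by apply: H_comp => //; apply: H_comp.
  by apply: H_comp => //; apply: H_comp.
by case: (sg i); case: (tau i) => // -[a b]; [rewrite b|rewrite a].
Qed.

End SmallIndex.
End CountableHull.

(** * The countable hull as values of terms *)

Section SkolemHull.
Variables (gen : seq T -> T -> T) (ext : (T -> T) -> seq T -> seq T -> T -> T).
Variables (mov : seq T -> seq T -> seq T -> T -> T).
Variables (glue : seq T -> seq T -> seq T -> (T -> T) -> (T -> T) -> T -> T).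

(** Trees with countable labels form a countable type, which serves as the index [K] of the hull. *)
Definition term := GenTree.tree (seq T + seq T * seq T * seq T).

(* The node labels 0-4 code composition, inverse, [ext], [mov] and [glue];
   ill-formed terms evaluate to the identity. *)
Fixpoint eval (t : term) : T -> T :=
  match t with
  | GenTree.Leaf (inl A) => gen A
  | GenTree.Node 0 [:: a; b] => eval a \o eval b
  | GenTree.Node 1 [:: a] => inverse (eval a)
  | GenTree.Node 2 [:: a; GenTree.Leaf (inr (A, V, _))] => ext (eval a) A V
  | GenTree.Node 3 [:: GenTree.Leaf (inr (V, V', W))] => mov V V' W
  | GenTree.Node 4 [:: a; b; GenTree.Leaf (inr (V, V', W))] =>
      glue V V' W (eval a) (eval b)
  | _ => id
  end.

Hypothesis gen_aut : forall A, aut (gen A).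
Hypothesis ext_aut : forall g A V, aut (ext g A V).
Hypothesis mov_aut : forall V V' W, aut (mov V V' W).
Hypothesis glue_aut : forall V V' W a b, aut (glue V V' W a b).

Lemma eval_aut t : aut (eval t).
Proof.
have ai := aut_id R; elim: t => [l|n l IH] /=.
  by case: l => // -[[A V] W].
have aV g : aut g -> aut (inverse g) by apply: aut_inverse.
have ac g h : aut g -> aut h -> aut (g \o h) by apply: aut_comp.
by repeat match goal with
| |- is_aut _ (match ?x with _ => _ end) => destruct x
end; move: IH => /=; intuition.
Qed.

End SkolemHull.

Hypothesis eppa : forall A V g, aut g -> sub A V -> sub (map g A) V ->
  exists g', [/\ aut g', agree g' g A & stab g' V].
Hypothesis amalgam : forall V V' W, sub V V' -> sub V W ->
  exists q, [/\ aut q, agree q id V & forall a b, aut a -> aut b ->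
    stab a W -> stab b (map q V') -> agree a b V -> stab a V ->
    exists c, [/\ aut c, agree c a W & agree c b (map q V')]].

(** Choice turns each existence statement into a total Skolem function with automorphisms as values,
    the identity where the premises fail. Hence every term denotes an automorphism. *)
Theorem small_index (H : (T -> T) -> Prop) :
  is_subgroup R H -> index_lt_continuum R H ->
  exists A, forall g, aut g -> agree g id A -> H g.
Proof.
move=> HH Hidx; apply: contrapT => nA; have ai := aut_id R.
have gen_ex A : exists g, [/\ aut g, agree g id A & ~ H g].
  apply: contrapT => ng; apply: nA; exists A => g ag gA.
  by apply: contrapT => nHg; apply: ng; exists g.
have ext_ex (x : (T -> T) * seq T * seq T) : exists g', aut g' /\
    let: (g, A, V) := x in aut g -> sub A V -> sub (map g A) V ->
    agree g' g A /\ stab g' V.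
  case: x => [[g A] V].
  case: (pselect [/\ aut g, sub A V & sub (map g A) V]) => [[h1 h2 h3]|nh].
    by have [g' [ag' e1 e2]] := eppa h1 h2 h3; exists g'.
  by exists id; split=> // h1 h2 h3; case: nh.
pose amal V V' W q := forall a b, aut a -> aut b ->
    stab a W -> stab b (map q V') -> agree a b V -> stab a V ->
    exists c, [/\ aut c, agree c a W & agree c b (map q V')].
have mov_ex (x : seq T * seq T * seq T) : exists q, aut q /\
    let: (V, V', W) := x in sub V V' -> sub V W -> agree q id V /\ amal V V' W q.
  case: x => [[V V'] W].
  case: (pselect (sub V V' /\ sub V W)) => [[h1 h2]|nh].
    by have [q [aq q1 q2]] := amalgam h1 h2; exists q.
  by exists id; split=> // h1 h2; case: nh.
pose mov V V' W := projT1 (cid (mov_ex (V, V', W))).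
have movP V V' W : aut (mov V V' W) /\ (sub V V' -> sub V W ->
    agree (mov V V' W) id V /\ amal V V' W (mov V V' W)).
  by rewrite /mov; case: cid.
have glue_ex (x : seq T * seq T * seq T * (T -> T) * (T -> T)) : exists c, aut c /\
    let: (V, V', W, a, b) := x in
    (exists c, [/\ aut c, agree c a W & agree c b (map (mov V V' W) V')]) ->
    agree c a W /\ agree c b (map (mov V V' W) V').
  case: x => [[[[V V'] W] a] b].
  case: (pselect (exists c, [/\ aut c, agree c a W & agree c b (map (mov V V' W) V')])).
    by case=> c [ac c1 c2]; exists c.
  by move=> nc; exists id; split=> // /nc.
pose gen A := projT1 (cid (gen_ex A)).
pose ext g A V := projT1 (cid (ext_ex (g, A, V))).
pose glue V V' W a b := projT1 (cid (glue_ex (V, V', W, a, b))).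
have genP A : [/\ aut (gen A), agree (gen A) id A & ~ H (gen A)].
  by rewrite /gen; case: cid.
have extP g A V : aut (ext g A V) /\ (aut g -> sub A V -> sub (map g A) V ->
    agree (ext g A V) g A /\ stab (ext g A V) V).
  by rewrite /ext; case: cid.
have glueP V V' W a b : aut (glue V V' W a b) /\
    ((exists c, [/\ aut c, agree c a W & agree c b (map (mov V V' W) V')]) ->
    agree (glue V V' W a b) a W /\ agree (glue V V' W a b) b (map (mov V V' W) V')).
  by rewrite /glue; case: cid.
pose e := eval gen ext mov glue.
have ea t : aut (e t).
  apply: eval_aut.
  - by move=> A; case: (genP A).
  - by move=> g A V; case: (extP g A V).
  - by move=> V V' W; case: (movP V V' W).
  - by move=> V V' W a b; case: (glueP V V' W a b).
apply: (@no_small_index term e _ _ _ _ _ _ H HH Hidx).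
- by move=> _ [t ->].
(* An ill-formed term, hence the identity. *)
- by exists (GenTree.Node 5 [::]).
- by move=> _ _ [t ->] [t' ->]; exists (GenTree.Node 0 [:: t; t']).
- by move=> _ [t ->]; exists (GenTree.Node 1 [:: t]).
- move=> _ A V [t ->] s1 s2; exists (ext (e t) A V).
  have [_ /(_ (ea t) s1 s2)[e1 e2]] := extP (e t) A V; split=> //.
  by exists (GenTree.Node 2 [:: t; GenTree.Leaf (inr (A, V, [::]))]).
- move=> V V' W s1 s2; have [_ /(_ s1 s2)[m1 m2]] := movP V V' W.
  exists (mov V V' W); split=> //.
    by exists (GenTree.Node 3 [:: GenTree.Leaf (inr (V, V', W))]).
  move=> _ _ [t ->] [t' ->] h1 h2 h3 h4; exists (glue V V' W (e t) (e t')).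
  have [_ /(_ (m2 _ _ (ea t) (ea t') h1 h2 h3 h4))[c1 c2]] := glueP V V' W (e t) (e t').
  split=> //.
  by exists (GenTree.Node 4 [:: t; t'; GenTree.Leaf (inr (V, V', W))]).
- move=> B; have [_ g1 g2] := genP B; exists (gen B); split=> //.
  by exists (GenTree.Leaf (inl B)).
Qed.

End ClosureSystem.

Theorem theorem1 (mm : nat) (T : countType) (R : rel T)
  (Hm : 2 <= mm) (HM : is_generic mm R)
  (H : (T -> T) -> Prop) (HH : is_subgroup R H)
  (Hidx : index_lt_continuum R H) :
  exists A : seq T,
    forall g : T -> T, is_aut R g ->
      (forall x, gcl R mm (fun y => y \in A) x -> g x = x) -> H g.
Proof.
have mm_gt0 : 0 < mm by apply: leq_trans Hm.
have [A HA] : exists A, forall g, is_aut R g -> agree (sm mm R) g id A -> H g.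
  apply: small_index HH Hidx.
  - exact: sm_ext.
  - exact: sm_closure.
  - exact: sm_map.
  - move=> A V g ag sA sgA; apply: sm_eppa => // x xA; apply: sgA; exact: map_f.
  - exact: sm_amalgam.
by exists A => g ag gA; apply: HA => // x sx; apply/gA/(sm_gcl HM).
Qed.
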